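(* Let $C>0$ be a constant. Let $u$ be a smooth, axially symmetric vector field which, together with a smooth pressure $p$, solves $$ \begin{cases} (u\cdot\nabla)u+\nabla p-\Delta u=0 & \text{in } \mathbb{R}^2\times[0,1],\\ \nabla\cdot u=0,\\ \lim_{|x'|\to\infty}u=0,\qquad u(x)|_{x_3=0}=u(x)|_{x_3=1}=0, \end{cases} $$ and suppose that for all $R\ge 1$ $$\int_0^1\int_{R\le|x'|\le 2R}|\nabla u(x)|^2\,dx<C<\infty .$$ Then $u^\theta=0$. Moreover, there exists a positive constant $C_0$, depending only on $C$, such that $$|u^r(x)|+|u^z(x)|\le C_0\left(\frac{\ln r}{r}\right)^{1/2}$$ for all $x\in\mathbb{R}^2\times[0,1]$ with $r=|x'|$ sufficiently large.
   Context: Write $x=(x',x_3)$ with $x'=(x_1,x_2)\in\mathbb{R}^2$ and $x_3=z\in[0,1]$. Use cylindrical coordinates $r=|x'|=\sqrt{x_1^2+x_2^2}$, $\theta=\tan^{-1}(x_2/x_1)$, $z$, and $e_r=(x_1/r,x_2/r,0)$, $e_\theta=(-x_2/r,x_1/r,0)$, $e_z=(0,0,1)$. An axially symmetric solution is one of the form $u(x)=u^r(r,z)e_r+u^\theta(r,z)e_\theta+u^z(r,z)e_z$, i.e. the components $u^r,u^\theta,u^z$ (and the pressure $p$) do not depend on $\theta$, and they satisfy $$ \begin{cases} (u^r\partial_r+u^z\partial_z)u^r-\frac{(u^\theta)^2}{r}+\partial_r p=(\partial_r^2+\frac1r\partial_r+\partial_z^2-\frac1{r^2})u^r,\\ (u^r\partial_r+u^z\partial_z)u^\theta+\frac{u^ru^\theta}{r}=(\partial_r^2+\frac1r\partial_r+\partial_z^2-\frac1{r^2})u^\theta,\\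 (u^r\partial_r+u^z\partial_z)u^z+\partial_z p=(\partial_r^2+\frac1r\partial_r+\partial_z^2)u^z,\\ \partial_ru^r+\frac{u^r}{r}+\partial_zu^z=0. \end{cases} $$ The limit $|x'|\to\infty$ is uniform in $x_3$. ''Sufficiently large'' means $r\ge r_0$ for some $r_0\geq 2$, which may depend on the solution $u$; the constant $C_0$ depends only on $C$. *)

(* Defs.v *)
From HB Require Import structures.
From mathcomp Require Import all_boot all_order all_algebra.
From mathcomp Require Import all_classical all_reals all_analysis.
Set Implicit Arguments.
Unset Strict Implicit.
Unset Printing Implicit Defensive.
Import Order.TTheory GRing.Theory Num.Theory.
Import numFieldNormedType.Exports.
Local Open Scope classical_set_scope.
Local Open Scope ring_scope.

(* Points x = (x1, x2, x3) and vectors of R^3 are row vectors: x1, x2, x3 are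
   [x 0 0], [x 0 1], [x 0 2%R]. Fields are total functions on R^3, but only
   their values on the closed slab R^2 x [0,1] are ever constrained. *)

Definition slab (R : realType) : set 'rV[R]_3 :=
  [set x : 'rV[R]_3 | 0 <= x 0 2 <= 1].

Definition open_slab (R : realType) : set 'rV[R]_3 :=
  [set x : 'rV[R]_3 | 0 < x 0 2 < 1].

Definition partial (R : realType) (i : 'I_3) (f : 'rV[R]_3 -> R)
  : 'rV[R]_3 -> R := fun x => 'D_(delta_mx 0 i) f x.

Definition iter_partial (R : realType) (s : seq 'I_3) (f : 'rV[R]_3 -> R)
  : 'rV[R]_3 -> R := foldr (@partial R) f s.

(* C^oo up to the boundary: f is continuous on the closed slab, and its partial
   derivatives of all orders exist in the open slab and extend continuously to
   the closed slab. *)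
Definition smooth_on_slab (R : realType) (f : 'rV[R]_3 -> R) : Prop :=
  {within @slab R, continuous f} /\
  forall s : seq 'I_3,
    (forall (i : 'I_3) (x : 'rV[R]_3), open_slab x ->
       derivable (iter_partial s f) x (delta_mx 0 i)) /\
    exists g : 'rV[R]_3 -> R,
      {within @slab R, continuous g} /\
      forall x, open_slab x -> g x = iter_partial s f x.

Definition component (R : realType) (u : 'rV[R]_3 -> 'rV[R]_3) (i : 'I_3)
  : 'rV[R]_3 -> R := fun x => u x 0 i.

Definition convection (R : realType) (u : 'rV[R]_3 -> 'rV[R]_3)
    (x : 'rV[R]_3) : 'rV[R]_3 :=
  \row_i \sum_(j < 3) u x 0 j * partial j (component u i) x.

Definition gradient (R : realType) (p : 'rV[R]_3 -> R)
    (x : 'rV[R]_3) : 'rV[R]_3 :=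
  \row_i partial i p x.

Definition laplacian (R : realType) (u : 'rV[R]_3 -> 'rV[R]_3)
    (x : 'rV[R]_3) : 'rV[R]_3 :=
  \row_i \sum_(j < 3) partial j (partial j (component u i)) x.

Definition divergence (R : realType) (u : 'rV[R]_3 -> 'rV[R]_3)
    (x : 'rV[R]_3) : R :=
  \sum_(i < 3) partial i (component u i) x.

Definition sqr_norm_grad (R : realType) (u : 'rV[R]_3 -> 'rV[R]_3)
    (x : 'rV[R]_3) : R :=
  \sum_(i < 3) \sum_(j < 3) partial j (component u i) x ^+ 2.

Definition axis_dist (R : realType) (x : 'rV[R]_3) : R :=
  Num.sqrt (x 0 0 ^+ 2 + x 0 1 ^+ 2).

Definition vec3 (R : realType) (a b c : R) : 'rV[R]_3 :=
  \row_(i < 3) [:: a; b; c]`_i.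

Definition e_r (R : realType) (x : 'rV[R]_3) : 'rV[R]_3 :=
  vec3 (x 0 0 / axis_dist x) (x 0 1 / axis_dist x) 0.

Definition e_theta (R : realType) (x : 'rV[R]_3) : 'rV[R]_3 :=
  vec3 (- x 0 1 / axis_dist x) (x 0 0 / axis_dist x) 0.

Definition e_z (R : realType) : 'rV[R]_3 := vec3 0 0 1.

(* The components are functions of (r, z) only. The frame e_r, e_theta is
   undefined on the axis r = 0, which is therefore excluded. *)
Definition axially_symmetric (R : realType) (u : 'rV[R]_3 -> 'rV[R]_3)
    (p : 'rV[R]_3 -> R) (ur utheta uz pr : R -> R -> R) : Prop :=
  forall x : 'rV[R]_3, slab x -> 0 < axis_dist x ->
    u x = ur (axis_dist x) (x 0 2) *: e_r x
          + utheta (axis_dist x) (x 0 2) *: e_theta x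
          + uz (axis_dist x) (x 0 2) *: e_z R
    /\ p x = pr (axis_dist x) (x 0 2).

(* By continuity up to the boundary, asking for the equations in the open slab
   or in the closed slab is the same. *)
Definition stationary_navier_stokes (R : realType)
    (u : 'rV[R]_3 -> 'rV[R]_3) (p : 'rV[R]_3 -> R) : Prop :=
  forall x : 'rV[R]_3, open_slab x ->
    convection u x + gradient p x - laplacian u x = 0 /\ divergence u x = 0.

Definition no_slip (R : realType) (u : 'rV[R]_3 -> 'rV[R]_3) : Prop :=
  forall x : 'rV[R]_3, x 0 2 = 0 \/ x 0 2 = 1 -> u x = 0.

Definition vanishes_at_infinity (R : realType)
    (u : 'rV[R]_3 -> 'rV[R]_3) : Prop :=
  forall eps : R, 0 < eps -> exists M : R,
    forall x : 'rV[R]_3, slab x -> M <= axis_dist x -> `|u x| < eps.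

(* The integral over rho <= |x'| <= 2 rho, 0 < z < 1 for the Lebesgue measure
   of R^3; the two faces, of measure zero, are left out because two-sided
   derivatives are not meaningful there. *)
Definition dyadic_dirichlet_integral (R : realType)
    (u : 'rV[R]_3 -> 'rV[R]_3) (rho : R) : \bar R :=
  (\int[(lebesgue_measure \x lebesgue_measure) \x lebesgue_measure]_(
      q in [set q : (R * R) * R |
              let x := vec3 q.1.1 q.1.2 q.2 in
              open_slab x /\ (rho <= axis_dist x <= 2 * rho)%R])
     (sqr_norm_grad u (vec3 q.1.1 q.1.2 q.2))%:E)%E.

(* Main.v *)
Require Import Defs.
From HB Require Import structures.
From mathcomp Require Import all_boot all_order all_algebra.
From mathcomp Require Import ring lra.
From mathcomp Require Import all_classical all_reals all_analysis.
Import Order.TTheory GRing.Theory Num.Theory.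
Import numFieldNormedType.Exports.
Local Open Scope classical_set_scope.
Local Open Scope ring_scope.

(** The velocity vanishes identically, and both conclusions follow at once.

    Write a, b, c for the radial, angular and axial components as functions of
    (r, z).  Since c vanishes on the walls, incompressibility gives a stream
    function psi = r int_0^z a, with psi_z = r a and psi_r = - r c.  On the
    upper wall psi does not depend on r, and it tends to 0 at the axis: the
    net flux through a cylinder r = const is 0 ([psi_top]).

    Let E(r) be the flux of energy through the cylinder of radius r,
    E = int_0^1 r (a a_r + b b_r + c c_r) - r a (|u|^2 / 2 + p) dz.
    Its derivative is the dissipation D(r) >= 0 on that cylinder
    ([energy_derivative]), and E(0+) = 0.  The pressure disappears from E:
    because psi = 0 on both walls, int r a p = - int psi p_z, and the axial
    momentum equation expresses p_z by the velocity.  Moving derivatives off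
    the velocity then gives E = S'' + G' + H, where S, G, H are z-integrals of
    products of a, b, c, psi without any derivative ([energy_flux]).

    Hence |S|, |G|, |H| are at most a multiple of K = int_0^1 r |u|^2 for
    r >= 1 ([flux_bounds]).  In turn K <= D by the Poincare inequality across
    the slab, and K <= 3 M^2 r because u, small at infinity and continuous, is
    bounded ([kinetic_bounds]).

    The conclusion is of Saint-Venant type.  Integrating E = S'' + G' + H
    against a weight that vanishes to second order at R and 2R gives both
    E(R) <= (A / R) E(2R), using K <= D = E', and E(R) <= B R, using K = O(r)
    ([saint_venant_step]).  Two uses of the first bound and one of the second
    give E(R) = O(1 / R); as E is nondecreasing and nonnegative, E = 0
    ([saint_venant]).  So D = 0, and u = 0 by Poincare again.

    The cylindrical equations come from the Cartesian ones on the half-plane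
    x2 = 0, where the derivatives across it are computed from the symmetry:
    along the line through (r, 0, z) in the direction x2, every component is a
    sum of functions of the distance to the axis, possibly multiplied by r or x2
    ([theta_partials]). *)

Set Implicit Arguments.
Unset Strict Implicit.
Unset Printing Implicit Defensive.

(** * One-variable calculus *)

(** [is_derive] is a class; behind this constant, instance resolution leaves
    derivatives alone and their values keep the shape given by the rules below. *)
Definition has_deriv (R : realType) (f : R -> R) (x d : R) : Prop :=
  is_derive x (1 : R) f d.

Section calculus.
Variable R : realType.
Implicit Types (f g df dg : R -> R) (x y a b c : R).

Lemma has_deriv_eq f x a b : has_deriv f x a -> a = b -> has_deriv f x b.
Proof. by move=> ? <-. Qed.

Lemma has_deriv_mul f g x a b : has_deriv f x a -> has_deriv g x b ->
  has_deriv (fun t => f t * g t) x (a * g x + f x * b).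
Proof.
move=> hf hg; apply: (is_derive_eq (is_deriveM hf hg)).
by rewrite /GRing.scale/=; ring.
Qed.

Lemma has_deriv_add f g x a b : has_deriv f x a -> has_deriv g x b ->
  has_deriv (fun t => f t + g t) x (a + b).
Proof. by move=> hf hg; exact: is_deriveD. Qed.

Lemma has_deriv_opp f x a : has_deriv f x a -> has_deriv (fun t => - f t) x (- a).
Proof. by move=> hf; exact: is_deriveN. Qed.

Lemma has_deriv_cst c x : has_deriv (fun=> c) x 0.
Proof. exact: is_derive_cst. Qed.

Lemma has_deriv_id x : has_deriv (fun t => t) x 1.
Proof. exact: is_derive_id. Qed.

Lemma has_deriv_inv x : x != 0 -> has_deriv (fun t => t^-1) x (- (x ^+ 2)^-1).
Proof.
move=> x0; apply: (is_derive_eq (@is_deriveV _ id x 1 1 x0 (is_derive_id _ _))).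
by rewrite /GRing.scale/= mulr1.
Qed.

Lemma has_deriv_comp f g x a b : has_deriv f (g x) a -> has_deriv g x b ->
  has_deriv (fun t => f (g t)) x (a * b).
Proof. by move=> hf hg; exact: is_derive1_comp. Qed.

Lemma has_deriv_near f g x a : (\forall t \near x, f t = g t) ->
  has_deriv f x a -> has_deriv g x a.
Proof. by move=> fg; apply: near_eq_is_derive. Qed.

Lemma has_deriv_unique f x a b : has_deriv f x a -> has_deriv f x b -> a = b.
Proof. by move=> [_ <-] [_ <-]. Qed.

Lemma ge0_has_deriv_le f df a b : a <= b ->
  (forall x, a <= x <= b -> has_deriv f x (df x)) ->
  (forall x, a <= x <= b -> 0 <= df x) -> f a <= f b.
Proof.
move=> ab fdf df0; rewrite -subr_ge0.
have [||c cab ->] := @MVT_segment _ f df _ _ ab.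
- by move=> x /subset_itv_oo_cc; rewrite in_itv; exact: fdf.
- apply: derivable_within_continuous => x; rewrite in_itv => /= xab.
  by case: (fdf x xab).
- by rewrite mulr_ge0 ?subr_ge0// df0//; move: cab; rewrite in_itv.
Qed.

End calculus.

Ltac derive_step :=
  first [ eassumption
        | apply: has_deriv_cst | apply: has_deriv_id
        | apply: has_deriv_add | apply: has_deriv_opp | apply: has_deriv_mul ].

(** * A Saint-Venant argument on the half-line *)

Section saint_venant.
Variable R : realType.

(** The second-order weight phi = ((r - r0) (2 r0 - r))^2 removes every boundary
    term when E = S'' + G' + H is integrated by parts on [r0, 2 r0].  What is
    left is E(r0) int phi <= const r0^4 int K, with int phi = r0^5 / 30, and K
    may be bounded by D = E' or by m r.  Instead of integrating, one compares
    E(r0) Phi, where Phi' = phi, with explicit primitives of the other terms. *)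
Lemma saint_venant_step (E D K S S1 S2 G G1 H : R -> R) (k m r0 : R) :
  0 <= k -> 0 <= m -> 1 <= r0 ->
  (forall r, r0 <= r -> has_deriv E r (D r)) ->
  (forall r, r0 <= r -> has_deriv S r (S1 r)) ->
  (forall r, r0 <= r -> has_deriv S1 r (S2 r)) ->
  (forall r, r0 <= r -> has_deriv G r (G1 r)) ->
  (forall r, r0 <= r -> E r = S2 r + G1 r + H r) ->
  (forall r, r0 <= r -> [/\ 0 <= K r, K r <= D r & K r <= m * r]) ->
  (forall r, r0 <= r ->
     [/\ `|S r| <= k * K r, `|G r| <= k * K r & `|H r| <= k * K r]) ->
  E r0 <= 150 * k / r0 * (E (2 * r0) - E r0) /\ E r0 <= 300 * k * m * r0.
Proof.
move=> k0 m0 r01 dE dS dS1 dG EE hK hb.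
have r0p : 0 < r0 by lra.
have E_mono r : r0 <= r -> E r0 <= E r.
  move=> r0r; apply: (@ge0_has_deriv_le _ E D) => // x /andP[x1 x2].
    exact: dE.
  by have [h1 h2 _] := hK x x1; exact: le_trans h2.
(* phi1 and phi2 are the derivatives of phi, and Phi is its primitive. *)
pose phi (r : R) := (r - r0) * (2 * r0 - r) * ((r - r0) * (2 * r0 - r)).
pose phi1 (r : R) := 2 * ((r - r0) * (2 * r0 - r) * (3 * r0 - 2 * r)).
pose phi2 (r : R) := 2 * ((3 * r0 - 2 * r) * (3 * r0 - 2 * r)
                          - 2 * ((r - r0) * (2 * r0 - r))).
pose Phi (r : R) := let t := r - r0 in
  r0 * r0 / 3 * (t * t * t) - r0 / 2 * (t * t * t * t) + 5^-1 * (t * t * t * t * t).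
have dphi r : has_deriv phi r (phi1 r).
  by rewrite /phi; apply: has_deriv_eq; [repeat derive_step|rewrite /phi1; ring].
have dphi1 r : has_deriv phi1 r (phi2 r).
  by rewrite /phi1; apply: has_deriv_eq; [repeat derive_step|rewrite /phi2; ring].
have dPhi r : has_deriv Phi r (phi r).
  by rewrite /Phi; apply: has_deriv_eq; [repeat derive_step|rewrite /phi; field].
(* W' = phi (S2 + G1) + phi1 G - phi2 S, where E - H replaces S2 + G1. *)
pose W r := phi r * (S1 r + G r) - phi1 r * S r.
pose W1 r := phi r * (E r - H r) + phi1 r * G r - phi2 r * S r.
have dW r : r0 <= r -> has_deriv W r (W1 r).
  move=> h; have := dphi r; have := dphi1 r; have := dS _ h; have := dS1 _ h.
  have := dG _ h => ? ? ? ? ?.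
  rewrite /W; apply: has_deriv_eq; first by repeat derive_step.
  by rewrite /W1 EE//; ring.
have W1_ge r : r0 <= r <= 2 * r0 ->
    phi r * E r0 - 5 * k * r0 ^+ 4 * K r <= W1 r.
  move=> /andP[r1 r2]; have [K0 _ _] := hK r r1; have [hS hG hH] := hb r r1.
  have t0 : 0 <= (r - r0) * (2 * r0 - r) by rewrite mulr_ge0; lra.
  have t1 : (r - r0) * (2 * r0 - r) <= r0 ^+ 2 by nra.
  have p0 : 0 <= phi r by rewrite /phi mulr_ge0.
  have p1 : phi r <= r0 ^+ 4.
    by rewrite /phi (_ : r0 ^+ 4 = r0 ^+ 2 * r0 ^+ 2); [exact: ler_pM|ring].
  have r34 : r0 ^+ 3 <= r0 ^+ 4 by rewrite ler_weXn2l.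
  have r24 : r0 ^+ 2 <= r0 ^+ 4 by rewrite ler_weXn2l.
  have p2 : `|phi1 r| <= 2 * r0 ^+ 4.
    rewrite /phi1 normrM ger0_norm// ler_wpM2l//.
    apply: le_trans r34; rewrite normrM ger0_norm// exprSr ler_pM//.
    by rewrite ler_norml; apply/andP; split; lra.
  have p3 : `|phi2 r| <= 2 * r0 ^+ 4.
    rewrite /phi2 normrM ger0_norm// ler_wpM2l//.
    apply: le_trans r24.
    have := sqr_ge0 (3 * r0 - 2 * r).
    have -> : (3 * r0 - 2 * r) * (3 * r0 - 2 * r) =
      r0 ^+ 2 - 4 * ((r - r0) * (2 * r0 - r)) by ring.
    have -> : (3 * r0 - 2 * r) ^+ 2 =
      r0 ^+ 2 - 4 * ((r - r0) * (2 * r0 - r)) by ring.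
    by move=> ?; rewrite ler_norml; apply/andP; split; lra.
  have q1 : phi r * E r0 <= phi r * E r by rewrite ler_wpM2l// E_mono.
  have kK0 : 0 <= k * K r by rewrite mulr_ge0.
  have q2 : phi r * H r <= r0 ^+ 4 * (k * K r).
    apply: le_trans (ler_norm _) _; rewrite normrM ler_pM//.
    by rewrite ger0_norm.
  have q3 : - (phi1 r * G r) <= 2 * r0 ^+ 4 * (k * K r).
    by rewrite lerNl; apply: lerNnormlW; rewrite normrM ler_pM.
  have q4 : phi2 r * S r <= 2 * r0 ^+ 4 * (k * K r).
    by apply: le_trans (ler_norm _) _; rewrite normrM ler_pM.
  have -> : W1 r = phi r * E r - phi r * H r + phi1 r * G r - phi2 r * S r.
    by rewrite /W1; ring.
  have -> : 5 * k * r0 ^+ 4 * K r =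
    r0 ^+ 4 * (k * K r) + 2 * r0 ^+ 4 * (k * K r) + 2 * r0 ^+ 4 * (k * K r) by ring.
  lra.
have ends : W r0 = 0 /\ W (2 * r0) = 0.
  by split; rewrite /W /phi /phi1; ring.
have Phi_ends : Phi r0 = 0 /\ Phi (2 * r0) = r0 ^+ 5 / 30.
  by split; rewrite /Phi/=; field.
have r02 : r0 <= 2 * r0 by lra.
have kr0 : 0 <= 5 * k * r0 ^+ 4 by rewrite mulr_ge0 ?exprn_ge0 ?mulr_ge0// ltW.
split.
(* int K <= int D = E (2 r0) - E r0 *)
- pose Y r := W r + 5 * k * r0 ^+ 4 * E r - E r0 * Phi r.
  pose Y1 r := W1 r + 5 * k * r0 ^+ 4 * D r - E r0 * phi r.
  have : Y r0 <= Y (2 * r0).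
    apply: (@ge0_has_deriv_le _ Y Y1 _ _ r02) => x /andP[x1 x2]; rewrite /Y /Y1.
  + have := dW _ x1; have := dE _ x1; have := dPhi x => ? ? ?.
    by apply: has_deriv_eq; [repeat derive_step|cbv beta; ring].
  + have [_ KD _] := hK x x1; have := @W1_ge x; rewrite x1 x2 => /(_ isT).
    have : 5 * k * r0 ^+ 4 * K x <= 5 * k * r0 ^+ 4 * D x by rewrite ler_wpM2l.
    lra.
  rewrite /Y; case: ends => -> ->; case: Phi_ends => -> -> h.
  have h2 : E r0 * r0 ^+ 5 <= 150 * k * r0 ^+ 4 * (E (2 * r0) - E r0) by lra.
  rewrite -(@ler_pM2r _ (r0 ^+ 5)) ?exprn_gt0//; apply: le_trans h2 _.
  rewrite le_eqVlt; apply/orP; left; apply/eqP; field.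
  by rewrite gt_eqF.
(* K <= m r <= 2 m r0 *)
- pose Y r := W r + 10 * k * m * r0 ^+ 5 * r - E r0 * Phi r.
  pose Y1 r := W1 r + 10 * k * m * r0 ^+ 5 - E r0 * phi r.
  have : Y r0 <= Y (2 * r0).
    apply: (@ge0_has_deriv_le _ Y Y1 _ _ r02) => x /andP[x1 x2]; rewrite /Y /Y1.
  + have := dW _ x1; have := dPhi x => ? ?.
    by apply: has_deriv_eq; [repeat derive_step|cbv beta; ring].
  + have [_ _ Km] := hK x x1; have := @W1_ge x; rewrite x1 x2 => /(_ isT).
    have : 5 * k * r0 ^+ 4 * K x <= 5 * k * r0 ^+ 4 * (m * (2 * r0)).
      by rewrite ler_wpM2l// (le_trans Km)// ler_wpM2l.
    have -> : 5 * k * r0 ^+ 4 * (m * (2 * r0)) = 10 * k * m * r0 ^+ 5 by ring.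
    lra.
  rewrite /Y; case: ends => -> ->; case: Phi_ends => -> -> h.
  have h2 : E r0 * r0 ^+ 5 <= 300 * k * m * r0 ^+ 5 * r0 by lra.
  rewrite -(@ler_pM2r _ (r0 ^+ 5)) ?exprn_gt0//; apply: le_trans h2 _.
  by rewrite le_eqVlt; apply/orP; left; apply/eqP; ring.
Qed.

(** The two bounds of [saint_venant_step] are E(r) <= (A / r) E(2r) and
    E(r) <= B r.  Using the first at s and 2s and the second at 4s yields
    E(s) <= 2 A^2 B / s, which tends to 0 while E is nondecreasing. *)
Lemma saint_venant (E D K S S1 S2 G G1 H : R -> R) (k m : R) :
  0 <= k -> 0 <= m ->
  (forall r, 1 <= r -> has_deriv E r (D r)) ->
  (forall r, 1 <= r -> has_deriv S r (S1 r)) ->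
  (forall r, 1 <= r -> has_deriv S1 r (S2 r)) ->
  (forall r, 1 <= r -> has_deriv G r (G1 r)) ->
  (forall r, 1 <= r -> E r = S2 r + G1 r + H r) ->
  (forall r, 1 <= r -> [/\ 0 <= K r, K r <= D r & K r <= m * r]) ->
  (forall r, 1 <= r ->
     [/\ `|S r| <= k * K r, `|G r| <= k * K r & `|H r| <= k * K r]) ->
  (forall r, 1 <= r -> 0 <= E r) ->
  forall r, 1 <= r -> E r = 0.
Proof.
move=> k0 m0 dE dS dS1 dG EE hK hb E0.
have [A A0 [B B0 step]] : exists2 A, 0 <= A & exists2 B, 0 <= B &
    forall r, 1 <= r -> E r <= A / r * E (2 * r) /\ E r <= B * r.
  exists (150 * k); first by lra.
  exists (300 * k * m); first by rewrite mulr_ge0//; lra.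
  move=> r.
  move=> r1; have up x : r <= x -> 1 <= x by exact: le_trans.
  have [h1 h2] : E r <= 150 * k / r * (E (2 * r) - E r) /\ E r <= 300 * k * m * r.
    apply: (@saint_venant_step E D K S S1 S2 G G1 H k m r k0 m0 r1) => x /up.
    - exact: dE.
    - exact: dS.
    - exact: dS1.
    - exact: dG.
    - exact: EE.
    - exact: hK.
    - exact: hb.
  split => //; apply: le_trans h1 _.
  rewrite ler_wpM2l//; first by apply: divr_ge0; lra.
  by have := E0 r r1; lra.
move=> r r1; apply/eqP; rewrite eq_le E0// andbT.
have decay s : r <= s -> E r <= 2 * A * A * B / s.
  move=> rs; have s1 : 1 <= s := le_trans r1 rs.
  have s0 : 0 < s by lra.
  have [h1 _] := step s s1; have [|h2 _] := step (2 * s); first by lra.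
  have [|_ h3] := step (2 * (2 * s)); first by lra.
  have Ers : E r <= E s.
    apply: (@ge0_has_deriv_le _ E D) => // x /andP[x1 _].
      by apply: dE; exact: le_trans x1.
    by have [|a b _] := hK x; [exact: le_trans x1|exact: le_trans b].
  apply: le_trans Ers _; apply: le_trans h1 _.
  have c1 : 0 <= A / s by apply: divr_ge0; lra.
  have c2 : 0 <= A / (2 * s) by apply: divr_ge0; lra.
  apply: le_trans (ler_wpM2l c1 h2) _.
  apply: le_trans (ler_wpM2l c1 (ler_wpM2l c2 h3)) _.
  by rewrite le_eqVlt; apply/orP; left; apply/eqP; field; rewrite gt_eqF.
rewrite leNgt; apply/negP => Er.
have c0 : 0 <= 2 * A * A * B by rewrite !mulr_ge0.
set c := 2 * A * A * B in decay c0.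
have s0 : 0 < r + c / E r by rewrite ltr_pwDl ?divr_ge0 ?(ltW Er)//; lra.
have := decay (r + c / E r); rewrite lerDl divr_ge0 ?(ltW Er)// => /(_ isT).
rewrite ler_pdivlMr// mulrDr mulrCA divff ?gt_eqF// mulr1.
have : 0 < E r * r by rewrite mulr_gt0//; lra.
lra.
Qed.

End saint_venant.

(** * Integrals across the slab *)

Definition cont01 (R : realType) (f : R -> R) : Prop :=
  {within `[0, 1]%classic, continuous f}.

(** The domain is open because the derivatives of the velocity are only taken at
    interior points of the slab. *)
Definition zint (R : realType) (b : R) (f : R -> R) : R :=
  \int[lebesgue_measure]_(z in `]0, b[%classic) f z.

Section integration.
Variable R : realType.
Implicit Types (f g F : R -> R) (b c z r : R).
Notation mu := (@lebesgue_measure R).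

Lemma cont01_cst c : cont01 (fun=> c).
Proof. by apply: continuous_subspaceT => x; exact: cvg_cst. Qed.

Lemma cont01_add f g : cont01 f -> cont01 g -> cont01 (fun z => f z + g z).
Proof. by move=> cf cg x; apply: cvgD; [exact: cf|exact: cg]. Qed.

Lemma cont01_mul f g : cont01 f -> cont01 g -> cont01 (fun z => f z * g z).
Proof. by move=> cf cg x; apply: cvgM; [exact: cf|exact: cg]. Qed.

Lemma cont01_opp f : cont01 f -> cont01 (fun z => - f z).
Proof. by move=> cf x; apply: cvgN; exact: cf. Qed.

Lemma cont01_norm f : cont01 f -> cont01 (fun z => `|f z|).
Proof. by move=> cf x; apply: cvg_norm; exact: cf. Qed.

Lemma cont01_integrable f : cont01 f -> mu.-integrable `[0, 1]%classic (EFin \o f).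
Proof. by move=> cf; apply: continuous_compact_integrable => //; exact: segment_compact. Qed.

Lemma cont01_integrable_oo f b : cont01 f -> b <= 1 ->
  mu.-integrable `]0, b[%classic (EFin \o f).
Proof.
move=> /cont01_integrable fi b1; apply: integrableS fi => //.
by apply: subset_itv; rewrite bnd_simp.
Qed.

Lemma cont01_continuous f z : cont01 f -> 0 < z < 1 -> {for z, continuous f}.
Proof.
move=> cf z01; apply: (within_continuous_continuous ltr01 cf).
by rewrite in_itv.
Qed.

Lemma zint_cc f b : cont01 f -> 0 <= b <= 1 ->
  zint b f = \int[mu]_(z in `[0, b]%classic) f z.
Proof.
move=> cf /andP[b0 b1]; have fi := cont01_integrable cf.
rewrite /zint Rintegral_itv_bndo_bndc; last exact: cont01_integrable_oo.
rewrite Rintegral_itv_obnd_cbnd//; apply: integrableS fi => //.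
by apply: subset_itv; rewrite bnd_simp.
Qed.

Lemma eq_zint f g b : (forall z, 0 < z < b -> f z = g z) -> zint b f = zint b g.
Proof. by move=> fg; apply: eq_Rintegral => z /set_mem/=; rewrite in_itv; exact: fg. Qed.

Lemma zint_add f g b : b <= 1 -> cont01 f -> cont01 g ->
  zint b (fun z => f z + g z) = zint b f + zint b g.
Proof. by move=> b1 cf cg; rewrite /zint RintegralD//; exact: cont01_integrable_oo. Qed.

Lemma zint_mull c f b : b <= 1 -> cont01 f -> zint b (fun z => c * f z) = c * zint b f.
Proof. by move=> b1 cf; rewrite /zint RintegralZl//; exact: cont01_integrable_oo. Qed.

Lemma zint_cst c b : 0 <= b -> zint b (fun=> c) = c * b.
Proof.
move=> b0; rewrite /zint Rintegral_cst//.
rewrite (_ : fine _ = b)//.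
set m := (X in fine X = _).
have -> : m = b%:E; last by [].
transitivity (mu `]0, b[%classic); first by [].
rewrite (lebesgue_measure_itv `]0, b[)/= lte_fin.
case: ltP => [_|b0']; first by rewrite sube0.
by congr EFin; apply/eqP; rewrite eq_le b0 b0'.
Qed.

Lemma zint_ge0 f b : (forall z, 0 < z < b -> 0 <= f z) -> 0 <= zint b f.
Proof. by move=> f0; apply: Rintegral_ge0 => z/=; rewrite in_itv; exact: f0. Qed.

Lemma zint_le f g b : b <= 1 -> cont01 f -> cont01 g ->
  (forall z, 0 < z < b -> f z <= g z) -> zint b f <= zint b g.
Proof.
move=> b1 cf cg fg; apply: le_Rintegral => //; exact: cont01_integrable_oo.
Qed.

Lemma zint_norm f b : b <= 1 -> cont01 f -> `|zint b f| <= zint b (fun z => `|f z|).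
Proof. by move=> b1 cf; apply: le_normr_Rintegral => //; exact: cont01_integrable_oo. Qed.

Lemma zint_norm_le f b B : 0 <= b <= 1 -> cont01 f ->
  (forall z, 0 < z < b -> `|f z| <= B) -> `|zint b f| <= B * b.
Proof.
move=> /andP[b0 b1] cf fB; apply: le_trans (zint_norm b1 cf) _.
rewrite -zint_cst//; apply: zint_le b1 _ _ fB; first exact: cont01_norm.
exact: cont01_cst.
Qed.

Lemma zint_subset f b : b <= 1 -> cont01 f -> (forall z, 0 <= f z) ->
  zint b f <= zint 1 f.
Proof.
move=> b1 cf f0; rewrite /zint /Rintegral fine_le//.
- by apply: integrable_fin_num => //; exact: cont01_integrable_oo.
- by apply: integrable_fin_num => //; exact: cont01_integrable_oo.
apply: ge0_subset_integral => //.
- have /integrableP[] := cont01_integrable_oo cf (lexx 1); exact.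
- by move=> z _; rewrite lee_fin.
- by apply: subset_itv; rewrite bnd_simp.
Qed.

Lemma zint_derivative F f b : 0 < b <= 1 -> cont01 F -> cont01 f ->
  (forall z, 0 < z < 1 -> has_deriv F z (f z)) -> zint b f = F b - F 0.
Proof.
move=> /andP[b0 b1] cF cf dF; rewrite zint_cc//; last by rewrite (ltW b0).
have sub : `[0, b]%classic `<=` `[0, 1]%classic.
  by apply: subset_itv; rewrite bnd_simp.
have wF := continuous_subspaceW sub cF.
have wf := continuous_subspaceW sub cf.
rewrite /Rintegral (@continuous_FTC2 _ f F 0 b b0 wf)//.
- have /continuous_within_itvP-/(_ b0)[_ F0 Fb] := wF; split => // z.
  rewrite in_itv/= => /andP[z0 zb]; have [|//] := dF z.
  by rewrite z0 (lt_le_trans zb).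
- move=> z; rewrite in_itv/= => /andP[z0 zb]; rewrite derive1E.
  have [|_ ->//] := dF z.
  by rewrite z0 (lt_le_trans zb).
Qed.

(** With x = F z = int_0^z f, expanding int_0^z (f - x)^2 >= 0 gives
    int_0^z f^2 >= (2 - z) x^2 >= x^2.  This is the Poincare inequality for
    functions vanishing on the lower wall, and also bounds the stream function. *)
Lemma sqr_le_zint_sqr F f z : 0 <= z <= 1 -> cont01 F -> cont01 f -> F 0 = 0 ->
  (forall z, 0 < z < 1 -> has_deriv F z (f z)) ->
  F z ^+ 2 <= zint 1 (fun z => f z * f z).
Proof.
move=> /andP[]; rewrite le_eqVlt => /predU1P[<- _ _ _ -> _|z0 z1 cF cf F0 dF].
  by rewrite expr0n/= zint_ge0// => t _; rewrite -expr2 sqr_ge0.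
have cff : cont01 (fun z => f z * f z) by exact: cont01_mul.
have z01 : 0 < z <= 1 by rewrite z0.
have Fz : zint z f = F z by rewrite (zint_derivative z01 cF cf dF) F0 subr0.
apply: (@le_trans _ _ (zint z (fun z => f z * f z))); last first.
  by apply: zint_subset => // t; rewrite -expr2 sqr_ge0.
have : 0 <= zint z (fun t => f t * f t + (- (2 * F z) * f t + F z ^+ 2)).
  by apply: zint_ge0 => t _; have := sqr_ge0 (f t - F z); lra.
have cc := cont01_cst.
rewrite !zint_add//; last 2 first.
- by apply: cont01_mul.
- by apply: cont01_add => //; exact: cont01_mul.
rewrite zint_mull// zint_cst ?(ltW z0)// Fz.
have := sqr_ge0 (F z); nra.
Qed.

Lemma zint_primitive f : cont01 f ->
  let F z := zint z f in
  [/\ cont01 F, F 0 = 0 & forall z, 0 < z < 1 -> has_deriv F z (f z)].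
Proof.
move=> cf F; have fi := cont01_integrable cf.
have FE z : 0 <= z <= 1 -> F z = \int[mu]_(t in `[0, z]%classic) f t.
  exact: zint_cc.
split.
- have /subspace_continuousP h := parameterized_integral_continuous (@ler01 R) fi.
  apply/subspace_continuousP => z z01.
  have z01' : 0 <= z <= 1 by move: z01; rewrite /= in_itv.
  have := h z z01; rewrite /from_subspace /parameterized_integral -(FE z z01').
  apply: cvg_trans; apply: near_eq_cvg.
  rewrite near_withinE; near=> t => t01.
  by rewrite FE//; move: t01; rewrite /= in_itv.
- rewrite FE ?lexx//= set_itv1 Rintegral_set1//.
- move=> z z01; have /andP[z0 z1] := z01.
  have [] := @continuous_FTC1_closed _ f 0 z 1 z1 fi z0 (cont01_continuous cf z01).
  move=> dF dFE.
  apply: (has_deriv_near (f := fun x => \int[mu]_(t in `[0, x]%classic) f t)).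
    near=> t; rewrite FE//; apply/andP; split; apply: ltW.
      by near: t; exact: lt_nbhsr.
    by near: t; exact: lt_nbhsl.
  by apply: DeriveDef; [exact: dF|rewrite -derive1E; exact: dFE].
Unshelve. all: end_near. Qed.

End integration.

(** The bound is uniform down to the axis r = 0: it dominates r-derivatives under
    the z-integral, and makes the integrals with a factor r vanish at the axis. *)
Definition strip_regular (R : realType) (f : R -> R -> R) : Prop :=
  (forall r : R, 0 < r -> cont01 (f r)) /\
  (forall L : R, exists B : R, forall r z : R, 0 < r <= L -> 0 < z < 1 -> `|f r z| <= B).

Section strip.
Variable R : realType.
Implicit Types (f g : R -> R -> R) (b c z r : R).

Lemma strip_regular_radial (h : R -> R) :
  (forall L : R, exists B : R, forall r, 0 < r <= L -> `|h r| <= B) ->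
  strip_regular (fun r _ => h r).
Proof.
move=> hB; split=> [r r0|L]; first exact: cont01_cst.
by have [B hL] := hB L; exists B => r z r0 _; exact: hL.
Qed.

Lemma strip_regular_cst c : strip_regular (fun _ _ => c).
Proof. by apply: (strip_regular_radial (h := fun=> c)) => L; exists `|c|. Qed.

Lemma strip_regular_r : strip_regular (fun r _ => r : R).
Proof.
apply: (strip_regular_radial (h := id)) => L; exists L => r /andP[r0 rL].
by rewrite gtr0_norm.
Qed.

Lemma strip_regular_add f g : strip_regular f -> strip_regular g ->
  strip_regular (fun r z => f r z + g r z).
Proof.
move=> [cf bf] [cg bg]; split=> [r r0|L]; first exact: cont01_add (cf _ r0) (cg _ r0).
have [B hB] := bf L; have [B' hB'] := bg L; exists (B + B') => r z rL z01.
by apply: le_trans (ler_normD _ _) _; rewrite lerD ?hB ?hB'.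
Qed.

Lemma strip_regular_mul f g : strip_regular f -> strip_regular g ->
  strip_regular (fun r z => f r z * g r z).
Proof.
move=> [cf bf] [cg bg]; split=> [r r0|L]; first exact: cont01_mul (cf _ r0) (cg _ r0).
have [B hB] := bf L; have [B' hB'] := bg L; exists (B * B') => r z rL z01.
by rewrite normrM ler_pM ?hB ?hB'.
Qed.

Lemma strip_regular_opp f : strip_regular f -> strip_regular (fun r z => - f r z).
Proof.
move=> [cf bf]; split=> [r r0|L]; first exact: cont01_opp (cf _ r0).
by have [B hB] := bf L; exists B => r z rL z01; rewrite normrN hB.
Qed.

Lemma has_deriv_zint f df b r : 0 < b <= 1 -> 0 < r ->
  strip_regular f -> strip_regular df ->
  (forall r z, 0 < r -> 0 < z < 1 -> has_deriv (fun t => f t z) r (df r z)) ->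
  has_deriv (fun t => zint b (f t)) r (zint b (df r)).
Proof.
move=> /andP[b0 b1] r0 [cf _] [cdf bdf] fdf.
have [B hB] := bdf (r + 1).
have I : `](r / 2), (r + 1)[%classic r by rewrite /= in_itv/=; apply/andP; split; lra.
have pos x : `](r / 2), (r + 1)[%classic x -> 0 < x <= r + 1.
  by rewrite /= in_itv/= => /andP[x1 x2]; apply/andP; split; lra.
have z01 z : `]0, b[%classic z -> 0 < z < 1.
  by rewrite /= in_itv/= => /andP[z0 zb]; rewrite z0 (lt_le_trans zb).
have intf x : `](r / 2), (r + 1)[%classic x ->
    (@lebesgue_measure R).-integrable `]0, b[%classic (EFin \o f x).
  by move=> /pos/andP[x0 _]; apply: cont01_integrable_oo => //; exact: cf.
have derf x z : `](r / 2), (r + 1)[%classic x -> `]0, b[%classic z ->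
    derivable (f ^~ z) x 1.
  by move=> /pos/andP[x0 _] /z01 z0; have [] := fdf x z x0 z0.
have d1E x z : 0 < x -> 0 < z < 1 -> partial1of2 f x z = df x z.
  by move=> x0 z0; rewrite partial1of2E; have [_ ->] := fdf x z x0 z0.
have G_ub x z : `](r / 2), (r + 1)[%classic x -> `]0, b[%classic z ->
    `|partial1of2 f x z| <= `|B|.
  move=> /pos xp /z01 zz; have /andP[x0 _] := xp; rewrite d1E//.
  by apply: le_trans (hB _ _ xp zz) (ler_norm _).
have intG : (@lebesgue_measure R).-integrable `]0, b[%classic (EFin \o (fun=> `|B|)).
  by apply: cont01_integrable_oo => //; exact: cont01_cst.
have G0 (z : R) : 0 <= `|B| by [].
have mb : measurable (`]0, b[%classic : set R) by [].
have dd : derivable (fun t => zint b (f t)) r 1.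
  exact: (@derivable_under_integral R _ _ (@lebesgue_measure R) f _ mb
    r (r / 2) (r + 1) I intf derf (fun=> `|B|) G0 intG G_ub).
have := @differentiation_under_integral R _ _ (@lebesgue_measure R) f _ mb
    r (r / 2) (r + 1) I intf derf (fun=> `|B|) G0 intG G_ub.
rewrite derive1E => dE; apply: DeriveDef => //.
rewrite [LHS]dE; apply: eq_zint => z /andP[z0 zb].
by rewrite d1E// z0 (lt_le_trans zb).
Qed.

End strip.

(** The two tactics decompose polynomial expressions by syntactic matching only;
    unification would unfold the ring operations. *)
Ltac cont_step :=
  lazymatch goal with
  | |- cont01 (fun z => @?f z + @?g z) => apply: (cont01_add (f := f) (g := g))
  | |- cont01 (fun z => @?f z * @?g z) => apply: (cont01_mul (f := f) (g := g))
  | |- cont01 (fun z => - @?f z) => apply: (cont01_opp (f := f))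
  | |- cont01 (fun _ => ?c) => exact: cont01_cst
  | |- _ => eassumption
  end.

Ltac strip_step :=
  lazymatch goal with
  | |- strip_regular (fun r z => @?f r z + @?g r z) =>
      apply: (strip_regular_add (f := f) (g := g))
  | |- strip_regular (fun r z => @?f r z * @?g r z) =>
      apply: (strip_regular_mul (f := f) (g := g))
  | |- strip_regular (fun r z => - @?f r z) => apply: (strip_regular_opp (f := f))
  | |- strip_regular (fun _ _ => ?c) => exact: strip_regular_cst
  | |- strip_regular (fun r _ => r) => exact: strip_regular_r
  | |- _ => eassumption
  end.

(** * The Liouville theorem in the half-strip *)

(** One velocity component in the variables (r, z).  Its derivatives, which exist
    for 0 < z < 1, come with an extension that is continuous up to the walls. *)
Record profile (R : realType) := Profile {
  prof :> R -> R -> R;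
  d_r : R -> R -> R;
  d_z : R -> R -> R;
  d_rr : R -> R -> R;
  d_zz : R -> R -> R;
  prof_reg : strip_regular prof;
  d_r_reg : strip_regular d_r;
  d_z_reg : strip_regular d_z;
  d_rr_reg : strip_regular d_rr;
  d_zz_reg : strip_regular d_zz;
  prof_r : forall r z, 0 < r -> 0 < z < 1 -> has_deriv (prof^~ z) r (d_r r z);
  prof_z : forall r z, 0 < r -> 0 < z < 1 -> has_deriv (prof r) z (d_z r z);
  prof_rr : forall r z, 0 < r -> 0 < z < 1 -> has_deriv (d_r^~ z) r (d_rr r z);
  prof_zz : forall r z, 0 < r -> 0 < z < 1 -> has_deriv (d_z r) z (d_zz r z);
  prof_bottom : forall r, 0 < r -> prof r 0 = 0;
  prof_top : forall r, 0 < r -> prof r 1 = 0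
}.

Lemma le0_of_le_small (R : realType) (x B e0 : R) : 0 < e0 ->
  (forall e, 0 < e <= e0 -> x <= e * B) -> x <= 0.
Proof.
move=> e00 h; rewrite leNgt; apply/negP => x0.
have B0 : 0 < B.
  have := h e0; rewrite e00 lexx => /(_ isT) /(lt_le_trans x0).
  by rewrite pmulr_rgt0.
pose e := Num.min e0 (x / (2 * B)).
have e_gt0 : 0 < e by rewrite lt_min e00 divr_gt0// mulr_gt0.
have := h e; rewrite e_gt0 ge_min lexx => /(_ isT).
have : e * B <= x / (2 * B) * B by rewrite ler_pM2r// ge_min lexx orbT.
rewrite (_ : x / (2 * B) * B = x / 2); last by field; rewrite gt_eqF.
lra.
Qed.

Section liouville.
Variables (R : realType) (a b c : profile R) (p pr pz : R -> R -> R) (M : R).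
Hypothesis p_reg : strip_regular p.
Hypothesis pr_reg : strip_regular pr.
Hypothesis pz_reg : strip_regular pz.
Hypothesis p_r : forall r z, 0 < r -> 0 < z < 1 -> has_deriv (p^~ z) r (pr r z).
Hypothesis p_z : forall r z, 0 < r -> 0 < z < 1 -> has_deriv (p r) z (pz r z).
Hypothesis momentum_r : forall r z, 0 < r -> 0 < z < 1 ->
  a r z * d_r a r z + c r z * d_z a r z - b r z ^+ 2 / r + pr r z =
  d_rr a r z + d_r a r z / r + d_zz a r z - a r z / r ^+ 2.
Hypothesis momentum_theta : forall r z, 0 < r -> 0 < z < 1 ->
  a r z * d_r b r z + c r z * d_z b r z + a r z * b r z / r =
  d_rr b r z + d_r b r z / r + d_zz b r z - b r z / r ^+ 2.
Hypothesis momentum_z : forall r z, 0 < r -> 0 < z < 1 ->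
  a r z * d_r c r z + c r z * d_z c r z + pz r z =
  d_rr c r z + d_r c r z / r + d_zz c r z.
Hypothesis incompressible : forall r z, 0 < r -> 0 < z < 1 ->
  d_r a r z + a r z / r + d_z c r z = 0.
Hypothesis M_ge0 : 0 <= M.
Hypothesis a_le : forall r z, 0 < r -> 0 < z < 1 -> `|a r z| <= M.
Hypothesis b_le : forall r z, 0 < r -> 0 < z < 1 -> `|b r z| <= M.
Hypothesis c_le : forall r z, 0 < r -> 0 < z < 1 -> `|c r z| <= M.

(** The stream function: psi_z = r a and psi_r = - r c. *)
Definition psi (r z : R) : R := r * zint z (a r).

Let cont_a r : 0 < r -> cont01 (a r). Proof. exact: (prof_reg a).1. Qed.
Let cont_b r : 0 < r -> cont01 (b r). Proof. exact: (prof_reg b).1. Qed.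
Let cont_c r : 0 < r -> cont01 (c r). Proof. exact: (prof_reg c).1. Qed.
Let cont_ar r : 0 < r -> cont01 (d_r a r). Proof. exact: (d_r_reg a).1. Qed.
Let cont_br r : 0 < r -> cont01 (d_r b r). Proof. exact: (d_r_reg b).1. Qed.
Let cont_cr r : 0 < r -> cont01 (d_r c r). Proof. exact: (d_r_reg c).1. Qed.
Let cont_az r : 0 < r -> cont01 (d_z a r). Proof. exact: (d_z_reg a).1. Qed.
Let cont_bz r : 0 < r -> cont01 (d_z b r). Proof. exact: (d_z_reg b).1. Qed.
Let cont_cz r : 0 < r -> cont01 (d_z c r). Proof. exact: (d_z_reg c).1. Qed.

Lemma psi_primitive r : 0 < r ->
  [/\ cont01 (psi r), psi r 0 = 0
    & forall z, 0 < z < 1 -> has_deriv (psi r) z (r * a r z)].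
Proof.
move=> r0; have [cF F0 dF] := zint_primitive (cont_a r0); split.
- apply: cont01_mul; [exact: cont01_cst|exact: cF].
- by rewrite /psi F0 mulr0.
- move=> z z01; have := dF z z01 => dFz.
  by apply: has_deriv_eq; [repeat derive_step|cbv beta; ring].
Qed.

(** Incompressibility reads (r a)_r = - r c_z, so the derivative in r of the integral
    of r a over [0, z] is - r c(z), as c vanishes on the lower wall. *)
Lemma psi_r r z : 0 < r -> 0 < z <= 1 ->
  has_deriv (fun t => psi t z) r (- (r * c r z)).
Proof.
move=> r0 z01; have /andP[z0 z1] := z01.
have ca := cont_a r0; have car := cont_ar r0.
have d := has_deriv_zint z01 r0 (prof_reg a) (d_r_reg a) (@prof_r _ a).
apply: has_deriv_eq; first by apply: has_deriv_mul; [exact: has_deriv_id|exact: d].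
cbv beta; rewrite mul1r -zint_mull// -zint_add//; last first.
  by repeat cont_step.
have -> : zint z (fun t => a r t + r * d_r a r t) = zint z (fun t => - r * d_z c r t).
  apply: eq_zint => t /andP[t0 tz]; have t01 : 0 < t < 1 by rewrite t0 (lt_le_trans tz).
  have -> : d_z c r t = - (d_r a r t + a r t / r).
    by have := incompressible r0 t01; lra.
  by field; rewrite gt_eqF.
rewrite zint_mull//; last exact: cont_cz.
rewrite (zint_derivative z01 (cont_c r0) (cont_cz r0)); last by move=> t; exact: prof_z.
by rewrite prof_bottom// subr0 mulNr.
Qed.

(** The net flux through cylinders is 0: on the upper wall psi_r = - r c = 0,
    so psi is constant in r, and it is O(r) near the axis. *)
Lemma psi_top r : 0 < r -> psi r 1 = 0.
Proof.
move=> r0; have o01 : 0 < (1 : R) <= 1 by rewrite ltr01 lexx.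
have d x : 0 < x -> has_deriv (fun t => psi t 1) x 0.
  by move=> x0; have := psi_r x0 o01; rewrite prof_top// mulr0 oppr0.
have const e : 0 < e <= r -> psi e 1 = psi r 1.
  move=> /andP[e0 er]; apply/eqP; rewrite eq_le; apply/andP; split.
    apply: (@ge0_has_deriv_le _ (fun t => psi t 1) (fun=> 0) e r er) => // x /andP[x1 _].
    by apply: d; exact: lt_le_trans x1.
  rewrite -lerN2.
  apply: (@ge0_has_deriv_le _ (fun t => - psi t 1) (fun=> 0) e r er) => // x /andP[x1 _].
  by rewrite -oppr0; apply: has_deriv_opp; apply: d; exact: lt_le_trans x1.
have [B hB] := (prof_reg a).2 r.
apply/eqP; rewrite -normr_le0; apply: (@le0_of_le_small _ _ B r r0) => e er.
have /andP[e0 _] := er; rewrite -(const e)// /psi normrM gtr0_norm// ler_pM2l//.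
rewrite -[leRHS]mulr1; apply: zint_norm_le; first by rewrite ler01 lexx.
  exact: cont_a.
by move=> z z01; exact: hB.
Qed.

Lemma psi_reg : strip_regular psi.
Proof.
split=> [r r0|L]; first by have [] := psi_primitive r0.
have [B hB] := (prof_reg a).2 L; exists (`|L| * `|B|) => r z rL /andP[z0 z1].
have /andP[r0 rL'] := rL.
rewrite /psi normrM ler_pM//; first by rewrite gtr0_norm// (le_trans rL')// ler_norm.
apply: (@le_trans _ _ (`|B| * z)); last by rewrite ler_piMr// ltW.
apply: zint_norm_le; [by rewrite !ltW|exact: cont_a|] => t /andP[t0 tz].
by apply: le_trans (ler_norm _); apply: hB; rewrite // t0 (lt_trans tz).
Qed.

(* e is r times the radial energy flux density and e1 its derivative in r; q1 and
   q2 are the dissipation densities, q1 with the z-derivatives; f1 is - r times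
   the axial energy flux density, and f1z its derivative in z. *)
Let e (r z : R) := r * (a r z * d_r a r z + b r z * d_r b r z + c r z * d_r c r z
  - a r z * (2^-1 * (a r z * a r z + b r z * b r z + c r z * c r z) + p r z)).
Let e1 (r z : R) :=
  (a r z * d_r a r z + b r z * d_r b r z + c r z * d_r c r z
    - a r z * (2^-1 * (a r z * a r z + b r z * b r z + c r z * c r z) + p r z))
  + r * (d_r a r z * d_r a r z + a r z * d_rr a r z
       + (d_r b r z * d_r b r z + b r z * d_rr b r z)
       + (d_r c r z * d_r c r z + c r z * d_rr c r z)
       - (d_r a r z * (2^-1 * (a r z * a r z + b r z * b r z + c r z * c r z) + p r z)
          + a r z * (a r z * d_r a r z + b r z * d_r b r z + c r z * d_r c r z + pr r z))).
Let q1 (r z : R) := r * (d_z a r z * d_z a r z + d_z b r z * d_z b r z + d_z c r z * d_z c r z).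
Let q2 (r z : R) := r * (d_r a r z * d_r a r z + d_r b r z * d_r b r z + d_r c r z * d_r c r z)
  + r^-1 * (a r z * a r z + b r z * b r z).
Let f1 (r z : R) :=
  r * (c r z * (2^-1 * (a r z * a r z + b r z * b r z + c r z * c r z) + p r z)
       - (a r z * d_z a r z + b r z * d_z b r z + c r z * d_z c r z)).
Let f1z (r z : R) :=
  r * (d_z c r z * (2^-1 * (a r z * a r z + b r z * b r z + c r z * c r z) + p r z)
       + c r z * (a r z * d_z a r z + b r z * d_z b r z + c r z * d_z c r z + pz r z)
       - (d_z a r z * d_z a r z + a r z * d_zz a r z
          + (d_z b r z * d_z b r z + b r z * d_zz b r z)
          + (d_z c r z * d_z c r z + c r z * d_zz c r z))).

Definition energy (r : R) := zint 1 (e r).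
Definition dissipation (r : R) := zint 1 (fun z => q1 r z + q2 r z).

Let le11 : (1 : R) <= 1. Proof. by []. Qed.
Let b01 : 0 < (1 : R) <= 1. Proof. by rewrite ltr01 lexx. Qed.

Let e_reg : strip_regular e.
Proof.
have := prof_reg a; have := prof_reg b; have := prof_reg c.
have := d_r_reg a; have := d_r_reg b; have := d_r_reg c => *.
by rewrite /e; repeat strip_step.
Qed.

Let e1_reg : strip_regular e1.
Proof.
have := prof_reg a; have := prof_reg b; have := prof_reg c.
have := d_r_reg a; have := d_r_reg b; have := d_r_reg c.
have := d_rr_reg a; have := d_rr_reg b; have := d_rr_reg c => *.
by rewrite /e1; repeat strip_step.
Qed.

Let f1_reg : strip_regular f1.
Proof.
have := prof_reg a; have := prof_reg b; have := prof_reg c.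
have := d_z_reg a; have := d_z_reg b; have := d_z_reg c => *.
by rewrite /f1; repeat strip_step.
Qed.

Let f1z_reg : strip_regular f1z.
Proof.
have := prof_reg a; have := prof_reg b; have := prof_reg c.
have := d_z_reg a; have := d_z_reg b; have := d_z_reg c.
have := d_zz_reg a; have := d_zz_reg b; have := d_zz_reg c => *.
by rewrite /f1z; repeat strip_step.
Qed.

Let q1_cont r : 0 < r -> cont01 (q1 r).
Proof.
move=> r0; have := cont_az r0; have := cont_bz r0; have := cont_cz r0 => *.
by rewrite /q1; repeat cont_step.
Qed.

Let q2_cont r : 0 < r -> cont01 (q2 r).
Proof.
move=> r0; have := cont_a r0; have := cont_b r0.
have := cont_ar r0; have := cont_br r0; have := cont_cr r0 => *.
by rewrite /q2; repeat cont_step.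
Qed.

(** The energy identity, integrated in z: e1 = q1 + q2 + f1z pointwise by the
    momentum equations, and the axial flux f1 vanishes on both walls. *)
Lemma energy_derivative r : 0 < r -> has_deriv energy r (dissipation r).
Proof.
move=> r0; have re : has_deriv energy r (zint 1 (e1 r)).
  apply: (has_deriv_zint b01 r0 e_reg e1_reg) => t z t0 z01.
  have := prof_r a t0 z01; have := prof_r b t0 z01; have := prof_r c t0 z01.
  have := prof_rr a t0 z01; have := prof_rr b t0 z01; have := prof_rr c t0 z01.
  have := p_r t0 z01 => ? ? ? ? ? ? ?.
  by rewrite /e /e1; apply: has_deriv_eq; [repeat derive_step|cbv beta; field].
apply: (has_deriv_eq re).
transitivity (zint 1 (fun z => q1 r z + q2 r z + f1z r z)).
  apply: eq_zint => z z01; rewrite /e1 /q1 /q2 /f1z.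
  have r_neq0 : r != 0 by rewrite gt_eqF.
  have := momentum_r r0 z01; have := momentum_theta r0 z01.
  have := momentum_z r0 z01; have := incompressible r0 z01.
  move: (a r z) (b r z) (c r z) (p r z) (pr r z) (pz r z) (d_r a r z) (d_r b r z)
   (d_r c r z) (d_z a r z) (d_z b r z) (d_z c r z) (d_rr a r z) (d_rr b r z)
   (d_rr c r z) (d_zz a r z) (d_zz b r z) (d_zz c r z).
  move=> A B C P PR PZ AR BR CR AZ BZ CZ ARR BRR CRR AZZ BZZ CZZ.
  (* eliminate d_z c, then both pressure derivatives and d_rr b *)
  move=> /eqP; rewrite addrC addr_eq0 => /eqP -> hz ht hr.
  have -> : PZ = CRR + CR / r + CZZ - A * CR - C * (- (AR + A / r)) by lra.
  have -> : PR = ARR + AR / r + AZZ - A / r ^+ 2 - A * AR - C * AZ + B ^+ 2 / r by lra.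
  have -> : BRR = A * BR + C * BZ + A * B / r - (BR / r + BZZ - B / r ^+ 2) by lra.
  by field.
have q1c := q1_cont r0; have q2c := q2_cont r0.
rewrite zint_add//; [|by apply: cont01_add|exact: f1z_reg.1].
rewrite (zint_derivative (F := f1 r) b01 (f1_reg.1 r r0) (f1z_reg.1 r r0)).
- by rewrite /f1 !prof_bottom// !prof_top// /dissipation; ring.
move=> z z01.
have := prof_z a r0 z01; have := prof_z b r0 z01; have := prof_z c r0 z01.
have := prof_zz a r0 z01; have := prof_zz b r0 z01; have := prof_zz c r0 z01.
have := p_z r0 z01 => ? ? ? ? ? ? ?.
by rewrite /f1 /f1z; apply: has_deriv_eq; [repeat derive_step|cbv beta; field].
Qed.

(* In the notation of [energy_flux], S, G, H are made of s, g and h; s1, s2 and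
   g1 are derivatives in r, f2 is the term lost by integration in z, f2z its
   derivative in z, and k0 is r |u|^2. *)
Let s (r z : R) := psi r z * c r z.
Let s1 (r z : R) := - (r * c r z) * c r z + psi r z * d_r c r z.
Let s2 (r z : R) := - (c r z * c r z) - 3 * (r * c r z * d_r c r z) + psi r z * d_rr c r z.
Let g (r z : R) :=
  r * (a r z * a r z + 2^-1 * (b r z * b r z) + 2 * (c r z * c r z))
  - psi r z * (a r z * c r z).
Let g1 (r z : R) :=
  (a r z * a r z + 2^-1 * (b r z * b r z) + 2 * (c r z * c r z))
  + r * (2 * (a r z * d_r a r z) + b r z * d_r b r z + 4 * (c r z * d_r c r z))
  - (- (r * c r z) * (a r z * c r z)
     + psi r z * (d_r a r z * c r z + a r z * d_r c r z)).
Let h (r z : R) :=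
  - (2^-1 * (b r z * b r z)) - r^-1 * (psi r z * (a r z * c r z))
  - 2^-1 * r * (a r z * (a r z * a r z + b r z * b r z + c r z * c r z)).
Let f2 (r z : R) :=
  psi r z * (d_z c r z - p r z - c r z * c r z).
Let f2z (r z : R) :=
  r * a r z * (d_z c r z - p r z - c r z * c r z)
  + psi r z * (d_zz c r z - pz r z - 2 * (c r z * d_z c r z)).
Let k0 (r z : R) := r * (a r z * a r z + b r z * b r z + c r z * c r z).

Let s_reg : strip_regular s.
Proof. by have := prof_reg c; have := psi_reg => *; rewrite /s; repeat strip_step. Qed.

Let s1_reg : strip_regular s1.
Proof.
have := psi_reg; have := prof_reg c; have := d_r_reg c => *.
by rewrite /s1; repeat strip_step.
Qed.

Let s2_reg : strip_regular s2.
Proof.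
have := psi_reg; have := prof_reg c; have := d_r_reg c; have := d_rr_reg c => *.
by rewrite /s2; repeat strip_step.
Qed.

Let g_reg : strip_regular g.
Proof.
have := psi_reg; have := prof_reg a; have := prof_reg b; have := prof_reg c => *.
by rewrite /g; repeat strip_step.
Qed.

Let g1_reg : strip_regular g1.
Proof.
have := psi_reg; have := prof_reg a; have := prof_reg b; have := prof_reg c.
have := d_r_reg a; have := d_r_reg b; have := d_r_reg c => *.
by rewrite /g1; repeat strip_step.
Qed.

Let f2_reg : strip_regular f2.
Proof.
have := psi_reg; have := prof_reg c; have := d_z_reg c => *.
by rewrite /f2; repeat strip_step.
Qed.

Let f2z_reg : strip_regular f2z.
Proof.
have := psi_reg; have := prof_reg c; have := d_z_reg c; have := d_zz_reg c.
have := prof_reg a => *.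
by rewrite /f2z; repeat strip_step.
Qed.

Let k0_reg : strip_regular k0.
Proof.
have := prof_reg a; have := prof_reg b; have := prof_reg c => *.
by rewrite /k0; repeat strip_step.
Qed.

Let h_cont r : 0 < r -> cont01 (h r).
Proof.
move=> r0; have := cont_a r0; have := cont_b r0; have := cont_c r0.
have := psi_reg.1 r r0 => *; by rewrite /h; repeat cont_step.
Qed.

Let z1W (z : R) : 0 < z < 1 -> 0 < z <= 1.
Proof. by move=> /andP[-> /ltW]. Qed.

Lemma s_derivative r : 0 < r -> has_deriv (fun t => zint 1 (s t)) r (zint 1 (s1 r)).
Proof.
move=> r0; apply: (has_deriv_zint b01 r0 s_reg s1_reg) => t z t0 z01.
have := prof_r c t0 z01; have := psi_r t0 (z1W z01) => ? ?.
by rewrite /s /s1; apply: has_deriv_eq; [repeat derive_step|cbv beta; field].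
Qed.

Lemma s1_derivative r : 0 < r -> has_deriv (fun t => zint 1 (s1 t)) r (zint 1 (s2 r)).
Proof.
move=> r0; apply: (has_deriv_zint b01 r0 s1_reg s2_reg) => t z t0 z01.
have := prof_r c t0 z01; have := prof_rr c t0 z01; have := psi_r t0 (z1W z01) => ? ? ?.
by rewrite /s1 /s2; apply: has_deriv_eq; [repeat derive_step|cbv beta; field].
Qed.

Lemma g_derivative r : 0 < r -> has_deriv (fun t => zint 1 (g t)) r (zint 1 (g1 r)).
Proof.
move=> r0; apply: (has_deriv_zint b01 r0 g_reg g1_reg) => t z t0 z01.
have := prof_r a t0 z01; have := prof_r b t0 z01; have := prof_r c t0 z01.
have := psi_r t0 (z1W z01) => ? ? ? ?.
by rewrite /g /g1; apply: has_deriv_eq; [repeat derive_step|cbv beta; field].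
Qed.

(** With S = int s, G = int g + S / r and H = int h + S / r^2, this is
    E = S'' + G' + H.  Pointwise, - r a p = psi p_z - (psi p)_z, and p_z is
    replaced through the axial momentum equation; there
    psi c_zz = (psi c_z)_z + a (r a)_r, because r c_z = - (r a)_r, and
    r (a c_r + c c_z) = (r a c)_r + (r c^2)_z.  All z-derivatives are collected
    in f2, which vanishes with psi on both walls. *)
Lemma energy_flux r : 0 < r ->
  energy r = zint 1 (s2 r) + zint 1 (g1 r) + r^-1 * zint 1 (s1 r) + zint 1 (h r).
Proof.
move=> r0.
have c1 := s1_reg.1 r r0; have c2 := s2_reg.1 r r0; have c3 := g1_reg.1 r r0.
have c4 := h_cont r0; have c5 := f2z_reg.1 r r0.
transitivity (zint 1 (fun z => s2 r z + g1 r z + r^-1 * s1 r z + h r z + f2z r z)).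
  apply: eq_zint => z z01; rewrite /e /s2 /g1 /s1 /h /f2z.
  have r_neq0 : r != 0 by rewrite gt_eqF.
  have := momentum_z r0 z01; have := incompressible r0 z01.
  move: (psi r z).
  move: (a r z) (b r z) (c r z) (p r z) (pz r z) (d_r a r z) (d_r b r z)
   (d_r c r z) (d_z c r z) (d_rr c r z) (d_zz c r z).
  move=> A B C P PZ AR BR CR CZ CRR CZZ PSI.
  move=> /eqP; rewrite addrC addr_eq0 => /eqP -> hz.
  have -> : PZ = CRR + CR / r + CZZ - A * CR - C * (- (AR + A / r)) by lra.
  by field.
rewrite (zint_add (f := fun z => s2 r z + g1 r z + r^-1 * s1 r z + h r z)
  (g := f2z r))//; last by repeat cont_step.
rewrite (zint_add (f := fun z => s2 r z + g1 r z + r^-1 * s1 r z) (g := h r))//;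
  last by repeat cont_step.
rewrite (zint_add (f := fun z => s2 r z + g1 r z) (g := fun z => r^-1 * s1 r z))//;
  try by repeat cont_step.
rewrite (zint_add (f := s2 r) (g := g1 r))// zint_mull//.
rewrite (zint_derivative (F := f2 r) b01 (f2_reg.1 r r0) (f2z_reg.1 r r0)).
- have [_ psi0 _] := psi_primitive r0.
  by rewrite /f2 psi0 psi_top// !mul0r subrr addr0.
move=> z z01.
have := prof_z c r0 z01; have := prof_zz c r0 z01; have := p_z r0 z01.
have [_ _ dpsi] := psi_primitive r0; have := dpsi z z01 => ? ? ? ?.
by rewrite /f2 /f2z; apply: has_deriv_eq; [repeat derive_step|cbv beta; field].
Qed.

Let poincare (f : profile R) r : 0 < r ->
  zint 1 (fun z => f r z * f r z) <= zint 1 (fun z => d_z f r z * d_z f r z).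
Proof.
move=> r0; have cf := (prof_reg f).1 r r0; have cfz := (d_z_reg f).1 r r0.
have sq z : 0 <= z <= 1 -> f r z ^+ 2 <= zint 1 (fun z => d_z f r z * d_z f r z).
  by move=> z01; apply: (sqr_le_zint_sqr z01 cf cfz); [exact: prof_bottom|move=> *; exact: prof_z].
rewrite -[leRHS]mulr1 -zint_cst//; apply: zint_le => //; try by repeat cont_step.
by move=> z /andP[z0 z1]; rewrite -expr2 sq// !ltW.
Qed.

Let k0E r : 0 < r -> zint 1 (k0 r) =
  r * (zint 1 (fun z => a r z * a r z) + zint 1 (fun z => b r z * b r z)
       + zint 1 (fun z => c r z * c r z)).
Proof.
move=> r0; have ca := cont_a r0; have cb := cont_b r0; have cc := cont_c r0.
rewrite /k0 zint_mull//; last by repeat cont_step.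
by rewrite !zint_add//; repeat cont_step.
Qed.

Let q1E r : 0 < r -> zint 1 (q1 r) =
  r * (zint 1 (fun z => d_z a r z * d_z a r z) + zint 1 (fun z => d_z b r z * d_z b r z)
       + zint 1 (fun z => d_z c r z * d_z c r z)).
Proof.
move=> r0; have ca := cont_az r0; have cb := cont_bz r0; have cc := cont_cz r0.
rewrite /q1 zint_mull//; last by repeat cont_step.
by rewrite !zint_add//; repeat cont_step.
Qed.

Let q1_le_dissipation r : 0 < r -> zint 1 (q1 r) <= dissipation r.
Proof.
move=> r0; have c1 := q1_cont r0; have c2 := q2_cont r0.
apply: zint_le => //; first by apply: cont01_add.
move=> z _; rewrite lerDl /q2.
by rewrite addr_ge0// mulr_ge0 ?invr_ge0 ?(ltW r0)// !addr_ge0// -expr2 sqr_ge0.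
Qed.

Let k0_ge0 r z : 0 < r -> 0 <= k0 r z.
Proof. by move=> r0; rewrite /k0 mulr_ge0 ?(ltW r0)// !addr_ge0// -expr2 sqr_ge0. Qed.

(** The first upper bound is the Poincare inequality, component by component. *)
Lemma kinetic_bounds r : 0 < r ->
  [/\ 0 <= zint 1 (k0 r), zint 1 (k0 r) <= dissipation r
    & zint 1 (k0 r) <= 3 * M ^+ 2 * r].
Proof.
move=> r0; split.
- by apply: zint_ge0 => z _; exact: k0_ge0.
- apply: le_trans (q1_le_dissipation r0).
  by rewrite k0E// q1E// ler_pM2l// !lerD// poincare.
- rewrite -[leRHS]mulr1 -zint_cst//; apply: zint_le => //.
  + exact: k0_reg.1.
  + exact: cont01_cst.
  move=> z z01; rewrite /k0 mulrC ler_pM2r//.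
  have sq (x : R) : `|x| <= M -> x * x <= M ^+ 2.
    by move=> xM; rewrite -expr2 -real_normK ?num_real// lerXn2r ?nnegrE.
  have := sq _ (a_le r0 z01); have := sq _ (b_le r0 z01); have := sq _ (c_le r0 z01).
  lra.
Qed.

(** |psi| <= r (int a^2)^(1/2) for every z, and 2 |psi c| <= psi^2 / r + r c^2. *)
Lemma stream_bound r : 0 < r -> zint 1 (fun z => `|psi r z * c r z|) <= zint 1 (k0 r).
Proof.
move=> r0; have ca := cont_a r0; have cc := cont_c r0; have cb := cont_b r0.
have [cpsi psi0 dpsi] := psi_primitive r0.
set A2 := zint 1 (fun z => a r z * a r z).
have A2_ge0 : 0 <= A2 by apply: zint_ge0 => z _; rewrite -expr2 sqr_ge0.
have psi_le z : 0 <= z <= 1 -> psi r z ^+ 2 <= r * r * A2.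
  move=> z01; have cra : cont01 (fun t => r * a r t) by repeat cont_step.
  apply: le_trans (sqr_le_zint_sqr z01 cpsi cra psi0 dpsi) _.
  rewrite -zint_mull//; last by repeat cont_step.
  rewrite le_eqVlt; apply/orP; left; apply/eqP; apply: eq_zint => t _; ring.
apply: (@le_trans _ _ (zint 1 (fun z => r * A2 + r * (c r z * c r z)))).
  apply: zint_le => //; [by apply: cont01_norm; apply: cont01_mul|by repeat cont_step|].
  move=> z /andP[z0 z1]; have zz : 0 <= z <= 1 by rewrite !ltW.
  have hp := psi_le z zz.
  rewrite -(@ler_pM2l _ r)// normrM.
  have hx : `|psi r z| ^+ 2 <= r * r * A2 by rewrite real_normK ?num_real.
  have hy : `|c r z| ^+ 2 = c r z ^+ 2 by rewrite real_normK ?num_real.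
  move: hx hy; move: (`|psi r z|) (`|c r z|) => x y hx hy.
  have := sqr_ge0 (x - r * y); have := sqr_ge0 (x + r * y).
  have -> : r * (r * A2 + r * (c r z * c r z)) = r * r * A2 + r ^+ 2 * y ^+ 2.
    by rewrite hy; ring.
  lra.
rewrite zint_add//; try by repeat cont_step.
rewrite zint_cst// mulr1 zint_mull//; last by repeat cont_step.
rewrite k0E// -/A2 !mulrDr.
have : 0 <= r * zint 1 (fun z => b r z * b r z).
  by rewrite mulr_ge0 ?(ltW r0)//; apply: zint_ge0 => z _; rewrite -expr2 sqr_ge0.
lra.
Qed.

Let zint_norm_le_k0 (f : R -> R) r (x y : R) : 0 < r -> cont01 f -> 0 <= y ->
  (forall z, 0 < z < 1 -> `|f z| <= x * k0 r z + y * `|psi r z * c r z|) ->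
  `|zint 1 f| <= (x + y) * zint 1 (k0 r).
Proof.
move=> r0 cf y0 hf; have ck := k0_reg.1 r r0; have cc := cont_c r0.
have [cpsi _ _] := psi_primitive r0.
have cn : cont01 (fun z => `|psi r z * c r z|) by apply: cont01_norm; apply: cont01_mul.
apply: le_trans (zint_norm _ cf) _ => //.
apply: (@le_trans _ _ (zint 1 (fun z => x * k0 r z + y * `|psi r z * c r z|))).
  by apply: zint_le => //; [exact: cont01_norm|repeat cont_step].
rewrite zint_add//; try by repeat cont_step.
rewrite (zint_mull x (f := k0 r))// (zint_mull y (f := fun z => `|psi r z * c r z|))//.
by rewrite mulrDl lerD2l ler_wpM2l// stream_bound.
Qed.

(** Every term of S, G, H is either quadratic in the velocity, hence controlled by
    k0, or contains the product psi c, for which [stream_bound] applies; a third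
    factor is at most M. *)
Lemma flux_bounds r : 1 <= r ->
  [/\ `|zint 1 (s r)| <= (3 + 2 * M) * zint 1 (k0 r),
      `|zint 1 (g r) + r^-1 * zint 1 (s r)| <= (3 + 2 * M) * zint 1 (k0 r)
    & `|r^-1 * r^-1 * zint 1 (s r) + zint 1 (h r)| <= (3 + 2 * M) * zint 1 (k0 r)].
Proof.
move=> r1; have r0 : 0 < r by lra.
have [K0 _ _] := kinetic_bounds r0.
have ri : 0 < r^-1 <= 1 by rewrite invr_gt0 r0 invf_le1.
have /andP[ri0 ri1] := ri.
have M0 := M_ge0.
have sK : `|zint 1 (s r)| <= (0 + 1) * zint 1 (k0 r).
  apply: zint_norm_le_k0 => //; first exact: s_reg.1.
  by move=> z _; rewrite mul0r add0r mul1r /s.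
have MK : 0 <= M * zint 1 (k0 r) by rewrite mulr_ge0.
have psiac z : 0 < z < 1 -> `|psi r z * (a r z * c r z)| <= M * `|psi r z * c r z|.
  move=> z01; rewrite mulrCA normrM ler_wpM2r//; exact: a_le.
have gK : `|zint 1 (g r)| <= (2 + M) * zint 1 (k0 r).
  apply: zint_norm_le_k0 => //; first exact: g_reg.1.
  move=> z z01; rewrite /g; apply: le_trans (ler_normB _ _) _.
  apply: lerD (psiac z z01); rewrite /k0.
  have ha := sqr_ge0 (a r z); have hb := sqr_ge0 (b r z); have hc := sqr_ge0 (c r z).
  rewrite ger0_norm; first by nra.
  by rewrite mulr_ge0 ?(ltW r0)//; lra.
have hK : `|zint 1 (h r)| <= ((1 + M) + M) * zint 1 (k0 r).
  apply: zint_norm_le_k0 => //; first exact: h_cont.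
  move=> z z01; rewrite /h; apply: le_trans (ler_normB _ _) _.
  have ha := sqr_ge0 (a r z); have hb := sqr_ge0 (b r z); have hc := sqr_ge0 (c r z).
  rewrite -opprD normrN.
  apply: le_trans (lerD (ler_normD _ _) (lexx _)) _.
  have t1 : `|2^-1 * (b r z * b r z)| <= k0 r z.
    rewrite ger0_norm; last by rewrite mulr_ge0// -expr2.
    by rewrite /k0; nra.
  have t2 : `|r^-1 * (psi r z * (a r z * c r z))| <= M * `|psi r z * c r z|.
    rewrite normrM gtr0_norm//; apply: le_trans (psiac z z01).
    by rewrite ler_piMl.
  have t3 : `|2^-1 * r * (a r z * (a r z * a r z + b r z * b r z + c r z * c r z))|
      <= M * k0 r z.
    rewrite (_ : 2^-1 * r * _ = a r z * (2^-1 * k0 r z)); last by rewrite /k0; ring.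
    have k00 := k0_ge0 z r0.
    rewrite normrM ler_pM ?a_le// ger0_norm; lra.
  lra.
have riS : `|r^-1 * zint 1 (s r)| <= zint 1 (k0 r).
  rewrite normrM gtr0_norm//; move: sK; rewrite add0r mul1r; apply: le_trans.
  by rewrite ler_piMl.
have riS2 : `|r^-1 * r^-1 * zint 1 (s r)| <= zint 1 (k0 r).
  rewrite -mulrA normrM gtr0_norm//; apply: le_trans riS.
  by rewrite ler_piMl.
split.
- by apply: le_trans sK _; lra.
- by apply: le_trans (ler_normD _ _) _; lra.
- by apply: le_trans (ler_normD _ _) _; lra.
Qed.

Lemma energy_mono r t : 0 < r -> r <= t -> energy r <= energy t.
Proof.
move=> r0 rt; apply: (@ge0_has_deriv_le _ energy dissipation r t rt) => x /andP[rx _].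
  by apply: energy_derivative; exact: lt_le_trans rx.
by have [|h1 h2 _] := @kinetic_bounds x; [exact: lt_le_trans rx|exact: le_trans h2].
Qed.

(** E is nondecreasing and carries a factor r, so it tends to 0 at the axis. *)
Lemma energy_ge0 r : 0 < r -> 0 <= energy r.
Proof.
move=> r0.
pose eta (r z : R) := a r z * d_r a r z + b r z * d_r b r z + c r z * d_r c r z
  - a r z * (2^-1 * (a r z * a r z + b r z * b r z + c r z * c r z) + p r z).
have eta_reg : strip_regular eta.
  have := prof_reg a; have := prof_reg b; have := prof_reg c.
  have := d_r_reg a; have := d_r_reg b; have := d_r_reg c => *.
  by rewrite /eta; repeat strip_step.
have [B hB] := eta_reg.2 r.
rewrite -oppr_le0; apply: (@le0_of_le_small _ _ B r r0) => t /andP[t0 tr].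
apply: (@le_trans _ _ (- energy t)); first by rewrite lerN2 energy_mono.
apply: le_trans (ler_norm _) _; rewrite normrN.
rewrite /energy (_ : e t = fun z => t * eta t z)// zint_mull//; last exact: eta_reg.1.
rewrite normrM gtr0_norm// ler_pM2l// -[leRHS]mulr1.
apply: zint_norm_le; [by rewrite ler01 lexx|exact: eta_reg.1|].
by move=> z z01; apply: hB; rewrite // t0.
Qed.

Lemma energy_eq0 r : 0 < r -> energy r = 0.
Proof.
have large t : 1 <= t -> energy t = 0.
  apply: (@saint_venant _ energy dissipation (fun t => zint 1 (k0 t))
    (fun t => zint 1 (s t)) (fun t => zint 1 (s1 t)) (fun t => zint 1 (s2 t))
    (fun t => zint 1 (g t) + t^-1 * zint 1 (s t))
    (fun t => zint 1 (g1 t)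
       + (- (t ^+ 2)^-1 * zint 1 (s t) + t^-1 * zint 1 (s1 t)))
    (fun t => t^-1 * t^-1 * zint 1 (s t) + zint 1 (h t)) (3 + 2 * M) (3 * M ^+ 2)).
  - by have := M_ge0; lra.
  - by rewrite mulr_ge0// sqr_ge0.
  - by move=> x x1; apply: energy_derivative; lra.
  - by move=> x x1; apply: s_derivative; lra.
  - by move=> x x1; apply: s1_derivative; lra.
  - move=> x x1; have x0 : 0 < x by lra.
    apply: has_deriv_add (g_derivative x0) _.
    apply: has_deriv_mul (s_derivative x0); apply: has_deriv_inv.
    by rewrite gt_eqF.
  - move=> x x1; have x0 : 0 < x by lra.
    by rewrite energy_flux//; field; rewrite gt_eqF.
  - by move=> x x1; apply: kinetic_bounds; lra.
  - by move=> x x1; exact: flux_bounds.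
  - by move=> x x1; apply: energy_ge0; lra.
move=> r0; apply/eqP; rewrite eq_le energy_ge0// andbT.
rewrite -(large (1 + r)); last by lra.
by apply: energy_mono => //; lra.
Qed.

Lemma dissipation_eq0 r : 0 < r -> dissipation r = 0.
Proof.
move=> r0; apply: (has_deriv_unique (energy_derivative r0)).
apply: (has_deriv_near (f := fun=> 0)); last exact: has_deriv_cst.
by near=> t; rewrite energy_eq0//; near: t; exact: lt_nbhsr.
Unshelve. all: end_near. Qed.

Theorem profile_liouville r z : 0 < r -> 0 <= z <= 1 ->
  [/\ a r z = 0, b r z = 0 & c r z = 0].
Proof.
move=> r0 z01; have := q1_le_dissipation r0; rewrite dissipation_eq0// q1E//.
have sq (f : profile R) : 0 <= f r z ^+ 2 <= zint 1 (fun z => d_z f r z * d_z f r z).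
  rewrite sqr_ge0; apply: (sqr_le_zint_sqr z01 ((prof_reg f).1 r r0) ((d_z_reg f).1 r r0)).
    exact: prof_bottom.
  by move=> *; exact: prof_z.
have /andP[a0 a1] := sq a; have /andP[b0 b1] := sq b; have /andP[c0 c1] := sq c.
rewrite pmulr_rle0// => sum0.
by split; apply/eqP; rewrite -sqrf_eq0; apply/eqP; lra.
Qed.

End liouville.

(** * From the slab to the half-plane *)

Section slab_functions.
Variable R : realType.
Implicit Types (f g : 'rV[R]_3 -> R) (r s z : R).

Lemma vec3_0 (x y z : R) : vec3 x y z 0 0 = x. Proof. by rewrite mxE. Qed.
Lemma vec3_1 (x y z : R) : vec3 x y z 0 1 = y. Proof. by rewrite mxE. Qed.
Lemma vec3_2 (x y z : R) : vec3 x y z 0 2 = z. Proof. by rewrite mxE. Qed.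

Lemma ord3P (P : 'I_3 -> Prop) : P 0 -> P 1 -> P 2 -> forall i, P i.
Proof.
move=> P0 P1 P2 [[|[|[|//]]] hi].
- by have -> : Ordinal hi = 0 by exact: val_inj.
- by have -> : Ordinal hi = 1 by exact: val_inj.
- by have -> : Ordinal hi = 2 by exact: val_inj.
Qed.

Lemma sum3 (F : 'I_3 -> R) : \sum_(i < 3) F i = F 0 + F 1 + F 2.
Proof.
rewrite !big_ord_recl big_ord0 addr0 addrA.
by congr (F _ + F _ + F _); exact: val_inj.
Qed.

Lemma vec3_shift0 h r s z : vec3 (h + r) s z = h *: delta_mx 0 0 + vec3 r s z.
Proof.
apply/rowP; apply: ord3P; rewrite !mxE /=; ring.
Qed.

Lemma vec3_shift1 h r s z : vec3 r (h + s) z = h *: delta_mx 0 1 + vec3 r s z.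
Proof. by apply/rowP; apply: ord3P; rewrite !mxE /=; ring. Qed.

Lemma vec3_shift2 h r s z : vec3 r s (h + z) = h *: delta_mx 0 2 + vec3 r s z.
Proof. by apply/rowP; apply: ord3P; rewrite !mxE /=; ring. Qed.

Lemma line_has_deriv f (x v : 'rV[R]_3) (l : R -> 'rV[R]_3) t :
  (forall h, l (h + t) = h *: v + x) -> derivable f x v ->
  has_deriv (fun t => f (l t)) t ('D_v f x).
Proof.
move=> lE fxv.
have lt : l t = x by rewrite -(add0r t) lE scale0r add0r.
have E : (fun h : R => h^-1 *: (((fun t => f (l t)) \o shift t) (h *: (1 : R)) - f (l t)))
   = (fun h : R => h^-1 *: ((f \o shift x) (h *: v) - f x)).
  by apply/funext => h /=; rewrite lt -lE scaler1.
apply: DeriveDef.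
- by move: fxv; rewrite /derivable -E.
- by rewrite /derive E.
Qed.

Lemma within_continuous_precomp (T U V : topologicalType) (A : set T) (B : set U)
    (F : T -> U) (g : U -> V) :
  {within B, continuous g} -> continuous F -> (forall x, A x -> B (F x)) ->
  {within A, continuous (fun x => g (F x))}.
Proof.
move=> /subspace_continuousP cg cF AB; apply/subspace_continuousP => x Ax.
apply: cvg_comp (cg _ (AB _ Ax)) => W /cF; rewrite /nbhs/= => FW.
by apply: filterS FW => y /= h Ay; apply: h; exact: AB.
Qed.

Lemma vec3E r z : vec3 r 0 z = r *: delta_mx 0 0 + z *: delta_mx 0 2 :> 'rV[R]_3.
Proof. by apply/rowP; apply: ord3P; rewrite !mxE /=; ring. Qed.

Lemma vec3_continuous : continuous (fun q : R * R => vec3 q.1 0 q.2).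
Proof.
have -> : (fun q : R * R => vec3 q.1 0 q.2) =
    (fun q => q.1 *: delta_mx 0 0 + q.2 *: delta_mx 0 2 : 'rV[R]_3).
  by apply/funext => q; exact: vec3E.
by move=> q; apply: cvgD; apply: cvgZr_tmp; [exact: cvg_fst|exact: cvg_snd].
Qed.

(** The bound comes from compactness of [0, L] x [0, 1]: continuity on the slab
    includes the axis and the walls. *)
Lemma slab_strip_regular g : {within @slab R, continuous g} ->
  strip_regular (fun r z => g (vec3 r 0 z)).
Proof.
move=> cg; split=> [r r0|L].
- apply: (within_continuous_precomp (F := vec3 r 0) cg).
    have -> : vec3 r 0 = (fun z => r *: delta_mx 0 0 + z *: delta_mx 0 2 : 'rV[R]_3).
      by apply/funext => z; exact: vec3E.
    by move=> z; apply: cvgD; [exact: cvg_cst|apply: cvgZr_tmp; exact: cvg_id].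
  by move=> z /=; rewrite in_itv/= /slab/= vec3_2.
- pose A : set (R * R) := `[0, L]%classic `*` `[0, 1]%classic.
  have cA : compact A.
    by apply: compact_setX; exact: segment_compact.
  have cgA : {within A, continuous (fun q : R * R => g (vec3 q.1 0 q.2))}.
    apply: (within_continuous_precomp cg vec3_continuous).
    by move=> q [_] /=; rewrite in_itv/= /slab/= vec3_2.
  have [B [Breal hB]] := compact_bounded (continuous_compact cgA cA).
  exists (B + 1) => r z /andP[r0 rL] /andP[z0 z1].
  have Aq : A (r, z).
    by rewrite /A/=; split; rewrite /= in_itv/= ?(ltW r0) ?(ltW z0) ?(ltW z1)//.
  have B1 : B < B + 1 by rewrite ltrDl.
  exact: (hB _ B1 _ (imageP (fun q : R * R => g (vec3 q.1 0 q.2)) Aq)).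
Qed.

End slab_functions.

Section reduction.
Variable R : realType.
Implicit Types (f : 'rV[R]_3 -> R) (r y z : R).

Lemma open_slab_vec3 r y z : 0 < z < 1 -> open_slab (vec3 r y z).
Proof. by rewrite /open_slab/= vec3_2. Qed.

Lemma smooth_deriv0 f s r y z : smooth_on_slab f -> 0 < z < 1 ->
  has_deriv (fun t => iter_partial s f (vec3 t y z)) r
    (iter_partial (0 :: s) f (vec3 r y z)).
Proof.
move=> [_ sf] z01; apply: (@line_has_deriv _ (iter_partial s f) (vec3 r y z)
  (delta_mx 0 0) (fun t => vec3 t y z)) => [h|]; first exact: vec3_shift0.
by have [d _] := sf s; apply: d; exact: open_slab_vec3.
Qed.

Lemma smooth_deriv1 f s r y z : smooth_on_slab f -> 0 < z < 1 ->
  has_deriv (fun t => iter_partial s f (vec3 r t z)) y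
    (iter_partial (1 :: s) f (vec3 r y z)).
Proof.
move=> [_ sf] z01; apply: (@line_has_deriv _ (iter_partial s f) (vec3 r y z)
  (delta_mx 0 1) (fun t => vec3 r t z)) => [h|]; first exact: vec3_shift1.
by have [d _] := sf s; apply: d; exact: open_slab_vec3.
Qed.

Lemma smooth_deriv2 f s r y z : smooth_on_slab f -> 0 < z < 1 ->
  has_deriv (fun t => iter_partial s f (vec3 r y t)) z
    (iter_partial (2 :: s) f (vec3 r y z)).
Proof.
move=> [_ sf] z01; apply: (@line_has_deriv _ (iter_partial s f) (vec3 r y z)
  (delta_mx 0 2) (fun t => vec3 r y t)) => [h|]; first exact: vec3_shift2.
by have [d _] := sf s; apply: d; exact: open_slab_vec3.
Qed.

Lemma smooth_extension f s : smooth_on_slab f -> exists G : R -> R -> R,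
  strip_regular G /\
  forall r z, 0 < z < 1 -> G r z = iter_partial s f (vec3 r 0 z).
Proof.
move=> [_ sf]; have [_ [g [cg gE]]] := sf s.
exists (fun r z => g (vec3 r 0 z)); split; first exact: slab_strip_regular.
by move=> r z z01; apply: gE; exact: open_slab_vec3.
Qed.

Lemma extension_deriv_r f s (G G1 : R -> R -> R) r z : smooth_on_slab f ->
  (forall r z, 0 < z < 1 -> G r z = iter_partial s f (vec3 r 0 z)) ->
  (forall r z, 0 < z < 1 -> G1 r z = iter_partial (0 :: s) f (vec3 r 0 z)) ->
  0 < z < 1 -> has_deriv (G^~ z) r (G1 r z).
Proof.
move=> sf GE G1E z01; rewrite G1E//.
have -> : G^~ z = (fun t => iter_partial s f (vec3 t 0 z)).
  by apply/funext => t; exact: GE.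
exact: smooth_deriv0.
Qed.

Lemma extension_deriv_z f s (G G1 : R -> R -> R) r z : smooth_on_slab f ->
  (forall r z, 0 < z < 1 -> G r z = iter_partial s f (vec3 r 0 z)) ->
  (forall r z, 0 < z < 1 -> G1 r z = iter_partial (2 :: s) f (vec3 r 0 z)) ->
  0 < z < 1 -> has_deriv (G r) z (G1 r z).
Proof.
move=> sf GE G1E z01; rewrite G1E//; have /andP[z0 z1] := z01.
apply: has_deriv_near (smooth_deriv2 s r 0 sf z01).
near=> t; rewrite GE//; apply/andP; split; near: t; [exact: lt_nbhsr|exact: lt_nbhsl].
Unshelve. all: end_near. Qed.

Lemma smooth_profile f : smooth_on_slab f ->
  (forall x : 'rV[R]_3, x 0 2 = 0 \/ x 0 2 = 1 -> f x = 0) ->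
  exists P : profile R, [/\ forall r z, P r z = f (vec3 r 0 z),
    forall r z, 0 < z < 1 -> d_r P r z = iter_partial [:: 0] f (vec3 r 0 z),
    forall r z, 0 < z < 1 -> d_z P r z = iter_partial [:: 2] f (vec3 r 0 z),
    forall r z, 0 < z < 1 -> d_rr P r z = iter_partial [:: 0; 0] f (vec3 r 0 z)
  & forall r z, 0 < z < 1 -> d_zz P r z = iter_partial [:: 2; 2] f (vec3 r 0 z)].
Proof.
move=> sf f0; pose G r z := f (vec3 r 0 z).
have Greg : strip_regular G by apply: slab_strip_regular; exact: sf.1.
have GE r z : 0 < z < 1 -> G r z = iter_partial [::] f (vec3 r 0 z) by [].
have [Gr [Grreg GrE]] := smooth_extension [:: 0] sf.
have [Gz [Gzreg GzE]] := smooth_extension [:: 2] sf.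
have [Grr [Grrreg GrrE]] := smooth_extension [:: 0; 0] sf.
have [Gzz [Gzzreg GzzE]] := smooth_extension [:: 2; 2] sf.
have dr r z : 0 < r -> 0 < z < 1 -> has_deriv (G^~ z) r (Gr r z).
  by move=> _; exact: extension_deriv_r GE GrE.
have dz r z : 0 < r -> 0 < z < 1 -> has_deriv (G r) z (Gz r z).
  by move=> _; exact: extension_deriv_z GE GzE.
have drr r z : 0 < r -> 0 < z < 1 -> has_deriv (Gr^~ z) r (Grr r z).
  by move=> _; exact: extension_deriv_r GrE GrrE.
have dzz r z : 0 < r -> 0 < z < 1 -> has_deriv (Gz r) z (Gzz r z).
  by move=> _; exact: extension_deriv_z GzE GzzE.
have G0 r : 0 < r -> G r 0 = 0 by move=> _; apply: f0; rewrite vec3_2; left.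
have G1 r : 0 < r -> G r 1 = 0 by move=> _; apply: f0; rewrite vec3_2; right.
exists (@Profile R G Gr Gz Grr Gzz Greg Grreg Gzreg Grrreg Gzzreg dr dz drr dzz G0 G1).
split; [move=> r z; reflexivity|exact: GrE|exact: GzE|exact: GrrE|exact: GzzE].
Qed.

(** The distance to the axis of the point (r, y, z). *)
Definition hyp (r y : R) : R := Num.sqrt (r ^+ 2 + y ^+ 2).

Lemma hyp_gt0 r y : 0 < r -> 0 < hyp r y.
Proof. by move=> r0; rewrite sqrtr_gt0 ltr_pwDl ?exprn_gt0 ?sqr_ge0. Qed.

Lemma hyp0 r : 0 < r -> hyp r 0 = r.
Proof. by move=> r0; rewrite /hyp expr0n/= addr0 sqrtr_sqr gtr0_norm. Qed.

Lemma hyp_deriv r y : 0 < r -> has_deriv (hyp r) y (y / hyp r y).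
Proof.
move=> r0; have q0 : 0 < r ^+ 2 + y ^+ 2 by rewrite ltr_pwDl ?exprn_gt0 ?sqr_ge0.
have h0 : hyp r y != 0 by rewrite gt_eqF// hyp_gt0.
apply: (has_deriv_eq (a := (2 * hyp r y)^-1 * (0 + (1 * y + y * 1)))); last by field.
apply: (has_deriv_comp (f := Num.sqrt) (g := fun t => r ^+ 2 + t * t)).
  by rewrite -expr2; exact: is_derive1_sqrt.
by repeat derive_step.
Qed.

Section transversal.
Variables (be be1 : R -> R) (be2 r : R).
Hypothesis r0 : 0 < r.
Hypothesis dbe : forall x, 0 < x -> has_deriv be x (be1 x).
Hypothesis dbe1 : has_deriv be1 r be2.

Lemma radial_deriv y :
  has_deriv (fun t => be (hyp r t)) y (be1 (hyp r y) * (y / hyp r y)).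
Proof. by apply: has_deriv_comp; [apply: dbe; exact: hyp_gt0|exact: hyp_deriv]. Qed.

(** At y = 0 only the factor y / hyp r y, which vanishes there with derivative
    1 / r, contributes. *)
Lemma radial_deriv2 :
  has_deriv (fun t => be1 (hyp r t) * (t / hyp r t)) 0 (be1 r / r).
Proof.
have r_neq0 : r != 0 by rewrite gt_eqF.
have h := hyp_deriv 0 r0.
have d1 : has_deriv (fun t => be1 (hyp r t)) 0 (be2 * (0 / hyp r 0)).
  by apply: has_deriv_comp h; rewrite hyp0.
have d2 : has_deriv (fun t => (hyp r t)^-1) 0 (- (hyp r 0 ^+ 2)^-1 * (0 / hyp r 0)).
  by apply: (has_deriv_comp (f := fun x => x^-1)) h; apply: has_deriv_inv; rewrite hyp0.
apply: has_deriv_eq; first by repeat derive_step.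
by cbv beta; rewrite hyp0//; field.
Qed.

End transversal.

Lemma quotient_deriv (al : R -> R) al1 x : 0 < x -> has_deriv al x al1 ->
  has_deriv (fun t => al t / t) x (al1 / x - al x / x / x).
Proof.
move=> x0 d; have x_neq0 : x != 0 by rewrite gt_eqF.
have dv := has_deriv_inv x_neq0.
apply: has_deriv_eq; first by repeat derive_step.
by cbv beta; field.
Qed.

Lemma transversal_partials f r z (phi phi1 : R -> R) d : smooth_on_slab f -> 0 < z < 1 ->
  (forall y, f (vec3 r y z) = phi y) ->
  (forall y, has_deriv phi y (phi1 y)) -> has_deriv phi1 0 d ->
  iter_partial [:: 1] f (vec3 r 0 z) = phi1 0 /\
  iter_partial [:: 1; 1] f (vec3 r 0 z) = d.
Proof.
move=> sf z01 fphi dphi dphi1.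
have first y : iter_partial [:: 1] f (vec3 r y z) = phi1 y.
  have := smooth_deriv1 [::] r y sf z01 => /has_deriv_unique; apply.
  have -> : (fun t => iter_partial [::] f (vec3 r t z)) = phi by apply/funext => t; exact: fphi.
  exact: dphi.
split; first exact: first.
have := smooth_deriv1 [:: 1] r 0 sf z01 => /has_deriv_unique; apply.
by have -> : (fun t => iter_partial [:: 1] f (vec3 r t z)) = phi1 by apply/funext.
Qed.

Lemma quotient_deriv2 (P : profile R) r z : 0 < r -> 0 < z < 1 ->
  exists d, has_deriv (fun t => d_r P t z / t - P t z / t / t) r d.
Proof.
move=> r0 z01; have r_neq0 : r != 0 by rewrite gt_eqF.
have dv := has_deriv_inv r_neq0.
have := prof_r P r0 z01; have := prof_rr P r0 z01 => ? ?.
by eexists; repeat derive_step.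
Qed.

Lemma entryD (v w : 'rV[R]_3) i : (v + w) 0 i = v 0 i + w 0 i.
Proof. exact: mxE. Qed.

Lemma entryN (v : 'rV[R]_3) i : (- v) 0 i = - v 0 i.
Proof. exact: mxE. Qed.

Lemma convection_entry (u : 'rV[R]_3 -> 'rV[R]_3) x i : convection u x 0 i =
  u x 0 0 * partial 0 (component u i) x + u x 0 1 * partial 1 (component u i) x
  + u x 0 2 * partial 2 (component u i) x.
Proof. by rewrite mxE sum3. Qed.

Lemma laplacian_entry (u : 'rV[R]_3 -> 'rV[R]_3) x i : laplacian u x 0 i =
  partial 0 (partial 0 (component u i)) x + partial 1 (partial 1 (component u i)) x
  + partial 2 (partial 2 (component u i)) x.
Proof. by rewrite mxE sum3. Qed.

Lemma mx_entry_le (v : 'rV[R]_3) i : `|v 0 i| <= `|v|.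
Proof. by rewrite [leRHS]/Num.Def.normr /= mx_normrE; apply/bigmax_geP; right => /=; exists (0, i). Qed.

Section axisymmetric.
Variables (u : 'rV[R]_3 -> 'rV[R]_3) (p : 'rV[R]_3 -> R) (ur utheta uz pr : R -> R -> R).
Hypothesis axi : axially_symmetric u p ur utheta uz pr.

Lemma axisymmetricE r y z : 0 < r -> 0 <= z <= 1 ->
  [/\ u (vec3 r y z) 0 0 = r * (ur (hyp r y) z / hyp r y) - y * (utheta (hyp r y) z / hyp r y),
      u (vec3 r y z) 0 1 = y * (ur (hyp r y) z / hyp r y) + r * (utheta (hyp r y) z / hyp r y),
      u (vec3 r y z) 0 2 = uz (hyp r y) z
    & p (vec3 r y z) = pr (hyp r y) z].
Proof.
move=> r0 z01; have dE : axis_dist (vec3 r y z) = hyp r y.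
  by rewrite /axis_dist vec3_0 vec3_1.
have [] := axi (x := vec3 r y z).
- by rewrite /slab/= vec3_2.
- by rewrite dE hyp_gt0.
rewrite dE vec3_2 => -> ->; rewrite /e_r /e_theta /e_z dE vec3_0 vec3_1.
by split=> //; rewrite !mxE /=; ring.
Qed.

Lemma half_planeE r z : 0 < r -> 0 <= z <= 1 ->
  [/\ u (vec3 r 0 z) 0 0 = ur r z, u (vec3 r 0 z) 0 1 = utheta r z,
      u (vec3 r 0 z) 0 2 = uz r z & p (vec3 r 0 z) = pr r z].
Proof.
move=> r0 z01; have [-> -> -> ->] := axisymmetricE 0 r0 z01.
by rewrite hyp0//; split=> //; field; rewrite gt_eqF.
Qed.

Hypothesis smooth_u : forall i, smooth_on_slab (component u i).
Hypothesis smooth_p : smooth_on_slab p.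
Hypothesis no_slip_u : no_slip u.

(** Derivatives in x2 at (r, 0, z).  With rho the distance to the axis,
    u1 = r (a / rho) - x2 (b / rho) and u2 = x2 (a / rho) + r (b / rho) along the
    line x1 = r.  A function of rho has first derivative 0 and second derivative
    be'(r) / r there, and x2 times it has second derivative 0. *)
Lemma theta_partials (a b c : profile R) r z : 0 < r -> 0 < z < 1 ->
  (forall r z, a r z = component u 0 (vec3 r 0 z)) ->
  (forall r z, b r z = component u 1 (vec3 r 0 z)) ->
  (forall r z, c r z = component u 2 (vec3 r 0 z)) ->
  [/\ partial 1 (component u 0) (vec3 r 0 z) = - (b r z / r)
    /\ partial 1 (partial 1 (component u 0)) (vec3 r 0 z) = d_r a r z / r - a r z / r ^+ 2,
      partial 1 (component u 1) (vec3 r 0 z) = a r z / r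
    /\ partial 1 (partial 1 (component u 1)) (vec3 r 0 z) = d_r b r z / r - b r z / r ^+ 2
    & partial 1 (component u 2) (vec3 r 0 z) = 0
    /\ partial 1 (partial 1 (component u 2)) (vec3 r 0 z) = d_r c r z / r].
Proof.
move=> r0 z01 aE bE cE; have r_neq0 : r != 0 by rewrite gt_eqF.
have zz : 0 <= z <= 1 by case/andP: z01 => z0 z1; rewrite !ltW.
pose q (P : profile R) t := P t z / t.
pose q1 (P : profile R) t := d_r P t z / t - P t z / t / t.
have dq P t : 0 < t -> has_deriv (q P) t (q1 P t).
  by move=> t0; apply: (quotient_deriv (al := fun t => P t z)) => //; exact: prof_r.
have rad2 P : has_deriv (fun t => q1 P (hyp r t) * (t / hyp r t)) 0 (q1 P r / r).
  by have [d hd] := quotient_deriv2 P r0 z01; exact: radial_deriv2 hd.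
have hyE y : 0 < hyp r y by exact: hyp_gt0.
have q_hyp P y : has_deriv (fun t => q P (hyp r t)) y (q1 P (hyp r y) * (y / hyp r y)).
  exact: (radial_deriv r0 (dq P)).
split.
- have ra := rad2 a; have rb := rad2 b; have qb := q_hyp b 0.
  have := @transversal_partials (component u 0) r z
    (fun y => r * q a (hyp r y) - y * q b (hyp r y))
    (fun y => r * (q1 a (hyp r y) * (y / hyp r y))
       - (q b (hyp r y) + y * (q1 b (hyp r y) * (y / hyp r y))))
    (q1 a r) (smooth_u 0) z01.
  case.
  + move=> y; rewrite /q aE bE /component.
    have [-> _ _ _] := axisymmetricE y r0 zz.
    by have [-> -> _ _] := half_planeE (hyE y) zz.
  + move=> y; have ? := q_hyp a y; have ? := q_hyp b y.
    by apply: has_deriv_eq; [repeat derive_step|cbv beta; ring].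
  + apply: has_deriv_eq; first by repeat derive_step.
    by cbv beta; rewrite hyp0//; field.
  rewrite /iter_partial/= => -> ->; rewrite hyp0// /q /q1; split; by field.
- have ra := rad2 a; have rb := rad2 b; have qa := q_hyp a 0.
  have := @transversal_partials (component u 1) r z
    (fun y => y * q a (hyp r y) + r * q b (hyp r y))
    (fun y => q a (hyp r y) + y * (q1 a (hyp r y) * (y / hyp r y))
       + r * (q1 b (hyp r y) * (y / hyp r y)))
    (q1 b r) (smooth_u 1) z01.
  case.
  + move=> y; rewrite /q aE bE /component.
    have [_ -> _ _] := axisymmetricE y r0 zz.
    by have [-> -> _ _] := half_planeE (hyE y) zz.
  + move=> y; have ? := q_hyp a y; have ? := q_hyp b y.
    by apply: has_deriv_eq; [repeat derive_step|cbv beta; ring].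
  + apply: has_deriv_eq; first by repeat derive_step.
    by cbv beta; rewrite hyp0//; field.
  rewrite /iter_partial/= => -> ->; rewrite hyp0// /q /q1; split; by field.
- have dc t : 0 < t -> has_deriv (fun t => c t z) t (d_r c t z).
    by move=> t0; exact: prof_r.
  have := @transversal_partials (component u 2) r z
    (fun y => c (hyp r y) z) (fun y => d_r c (hyp r y) z * (y / hyp r y))
    (d_r c r z / r) (smooth_u 2) z01.
  case.
  + move=> y; rewrite cE /component.
    have [_ _ -> _] := axisymmetricE y r0 zz.
    by have [_ _ -> _] := half_planeE (hyE y) zz.
  + by move=> y; exact: (radial_deriv r0 dc).
  + exact: (radial_deriv2 (be1 := fun t => d_r c t z) r0 (prof_rr c r0 z01)).
  by rewrite /iter_partial/= => -> ->; split => //; rewrite mul0r mulr0.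
Qed.

Lemma theta_partial_pressure (P Pr : R -> R -> R) r z : 0 < r -> 0 < z < 1 ->
  (forall r z, P r z = p (vec3 r 0 z)) ->
  (forall t, 0 < t -> has_deriv (P^~ z) t (Pr t z)) ->
  partial 1 p (vec3 r 0 z) = 0.
Proof.
move=> r0 z01 PE dP.
have zz : 0 <= z <= 1 by case/andP: z01 => z0 z1; rewrite !ltW.
have := smooth_deriv1 [::] r 0 smooth_p z01 => /has_deriv_unique; apply.
have -> : (fun t => iter_partial [::] p (vec3 r t z)) = (fun t => P (hyp r t) z).
  apply/funext => y; rewrite PE /=.
  have [_ _ _ ->] := axisymmetricE y r0 zz.
  by have [_ _ _ ->] := half_planeE (hyp_gt0 y r0) zz.
by apply: has_deriv_eq; [exact: (radial_deriv r0 dP)|rewrite mul0r mulr0].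
Qed.

Hypothesis ns : stationary_navier_stokes u p.
Hypothesis decay : vanishes_at_infinity u.

(** Small far from the axis, and continuous on the compact rest of the half-strip. *)
Lemma velocity_bounded (i : 'I_3) : exists M : R, 0 <= M /\
  forall r z, 0 < r -> 0 < z < 1 -> `|u (vec3 r 0 z) 0 i| <= M.
Proof.
have [L hL] := decay ltr01.
have [_ reg] := slab_strip_regular (smooth_u i).1.
have [B hB] := reg L; exists (1 + `|B|); split; first by rewrite addr_ge0.
move=> r z r0 z01; have [rL|Lr] := leP r L.
  apply: (@le_trans _ _ B); first by apply: hB; rewrite // r0.
  by apply: le_trans (ler_norm _) _; rewrite lerDr.
apply: le_trans (mx_entry_le _ _) _; apply: (@le_trans _ _ 1); last by rewrite lerDl.
apply/ltW/hL; first by rewrite /slab/= vec3_2; case/andP: z01 => z0 z1; rewrite !ltW.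
by rewrite /axis_dist vec3_0 vec3_1 -/(hyp r 0) hyp0// ltW.
Qed.

Theorem axisymmetric_liouville r z : 0 < r -> 0 <= z <= 1 ->
  [/\ ur r z = 0, utheta r z = 0 & uz r z = 0].
Proof.
move=> r0 zz.
have bc i (x : 'rV[R]_3) : x 0 2 = 0 \/ x 0 2 = 1 -> component u i x = 0.
  by move=> /no_slip_u ux; rewrite /component ux mxE.
have [a [aE arE azE arrE azzE]] := smooth_profile (smooth_u 0) (bc 0).
have [b [bE brE bzE brrE bzzE]] := smooth_profile (smooth_u 1) (bc 1).
have [c [cE crE czE crrE czzE]] := smooth_profile (smooth_u 2) (bc 2).
pose P (r z : R) := p (vec3 r 0 z).
have PE s t : 0 < t < 1 -> P s t = iter_partial [::] p (vec3 s 0 t) by [].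
have Preg : strip_regular P by apply: slab_strip_regular; exact: smooth_p.1.
have [Pr [Prreg PrE]] := smooth_extension [:: 0] smooth_p.
have [Pz [Pzreg PzE]] := smooth_extension [:: 2] smooth_p.
have dPr s t : 0 < s -> 0 < t < 1 -> has_deriv (P^~ t) s (Pr s t).
  by move=> _; exact: extension_deriv_r PE PrE.
have dPz s t : 0 < s -> 0 < t < 1 -> has_deriv (P s) t (Pz s t).
  by move=> _; exact: extension_deriv_z PE PzE.
have [M0 [M0_ge0 hM0]] := velocity_bounded 0.
have [M1 [M1_ge0 hM1]] := velocity_bounded 1.
have [M2 [M2_ge0 hM2]] := velocity_bounded 2.
have eqs s t : 0 < s -> 0 < t < 1 ->
  [/\ a s t * d_r a s t + c s t * d_z a s t - b s t ^+ 2 / s + Pr s t =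
      d_rr a s t + d_r a s t / s + d_zz a s t - a s t / s ^+ 2,
      a s t * d_r b s t + c s t * d_z b s t + a s t * b s t / s =
      d_rr b s t + d_r b s t / s + d_zz b s t - b s t / s ^+ 2,
      a s t * d_r c s t + c s t * d_z c s t + Pz s t =
      d_rr c s t + d_r c s t / s + d_zz c s t
    & d_r a s t + a s t / s + d_z c s t = 0].
  move=> s0 t01; have s_neq0 : s != 0 by rewrite gt_eqF.
  have [mom div] := ns (open_slab_vec3 s 0 t01).
  have [[a1 a11] [b1 b11] [c1 c11]] := theta_partials s0 t01 aE bE cE.
  have p1 : partial 1 p (vec3 s 0 t) = 0.
    by apply: (theta_partial_pressure (P := P) (Pr := Pr)) => // x x0; exact: dPr.
  have mom_i i : u (vec3 s 0 t) 0 0 * partial 0 (component u i) (vec3 s 0 t)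
      + u (vec3 s 0 t) 0 1 * partial 1 (component u i) (vec3 s 0 t)
      + u (vec3 s 0 t) 0 2 * partial 2 (component u i) (vec3 s 0 t)
      + partial i p (vec3 s 0 t)
      - (partial 0 (partial 0 (component u i)) (vec3 s 0 t)
         + partial 1 (partial 1 (component u i)) (vec3 s 0 t)
         + partial 2 (partial 2 (component u i)) (vec3 s 0 t)) = 0.
    have := congr1 (fun v : 'rV[R]_3 => v 0 i) mom.
    rewrite !entryD !entryN convection_entry laplacian_entry.
    by rewrite [gradient _ _ _ _]mxE [X in _ = X -> _]mxE.
  have := mom_i 0; have := mom_i 1; have := mom_i 2.
  move: div; rewrite /divergence sum3.
  rewrite a1 a11 b1 b11 c1 c11 p1.
  move: (arE s t t01) (azE s t t01) (arrE s t t01) (azzE s t t01).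
  move: (brE s t t01) (bzE s t t01) (brrE s t t01) (bzzE s t t01).
  move: (crE s t t01) (czE s t t01) (crrE s t t01) (czzE s t t01).
  move: (PrE s t t01) (PzE s t t01); rewrite /iter_partial/=.
  move=> <- <- <- <- <- <- <- <- <- <- <- <- <- <-.
  rewrite -[u (vec3 s 0 t) 0 0]/(component u 0 (vec3 s 0 t)) -aE.
  rewrite -[u (vec3 s 0 t) 0 1]/(component u 1 (vec3 s 0 t)) -bE.
  rewrite -[u (vec3 s 0 t) 0 2]/(component u 2 (vec3 s 0 t)) -cE.
  move: (a s t) (b s t) (c s t) (Pr s t) (Pz s t) (d_r a s t) (d_r b s t)
   (d_r c s t) (d_z a s t) (d_z b s t) (d_z c s t) (d_rr a s t) (d_rr b s t)
   (d_rr c s t) (d_zz a s t) (d_zz b s t) (d_zz c s t).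
  move=> A B C PR PZ AR BR CR AZ BZ CZ ARR BRR CRR AZZ BZZ CZZ div m2 m1 m0.
  split=> //; apply/subr0_eq; [rewrite -m0|rewrite -m1|rewrite -m2]; ring.
have [a0 b0 c0] : [/\ a r z = 0, b r z = 0 & c r z = 0].
  apply: (@profile_liouville R a b c P Pr Pz (M0 + M1 + M2) Preg Prreg Pzreg dPr dPz _ _ _ _ _
    _ _ _ r z r0 zz).
  - by move=> s t s0 t01; have [] := eqs s t s0 t01.
  - by move=> s t s0 t01; have [] := eqs s t s0 t01.
  - by move=> s t s0 t01; have [] := eqs s t s0 t01.
  - by move=> s t s0 t01; have [] := eqs s t s0 t01.
  - by rewrite !addr_ge0.
  - move=> s t s0 t01; rewrite aE; apply: le_trans (hM0 _ _ s0 t01) _; lra.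
  - move=> s t s0 t01; rewrite bE; apply: le_trans (hM1 _ _ s0 t01) _; lra.
  - move=> s t s0 t01; rewrite cE; apply: le_trans (hM2 _ _ s0 t01) _; lra.
have [<- <- <- _] := half_planeE r0 zz.
by rewrite -[u _ _ _]aE -[u _ _ 1]bE -[u _ _ 2]cE.
Qed.

End axisymmetric.

End reduction.

Theorem theorem1p4 (R : realType) (C : R) (hC : 0 < C) :
  exists C0 : R, 0 < C0 /\
  forall (u : 'rV[R]_3 -> 'rV[R]_3) (p : 'rV[R]_3 -> R)
         (ur utheta uz pr : R -> R -> R),
    (forall i : 'I_3, smooth_on_slab (component u i)) ->
    smooth_on_slab p ->
    axially_symmetric u p ur utheta uz pr ->
    stationary_navier_stokes u p ->
    vanishes_at_infinity u ->
    no_slip u ->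
    (forall rho : R, 1 <= rho -> (dyadic_dirichlet_integral u rho < C%:E)%E) ->
    (forall r z : R, 0 < r -> 0 <= z <= 1 -> utheta r z = 0) /\
    exists r0 : R, 2 <= r0 /\
      forall x : 'rV[R]_3, slab x -> r0 <= axis_dist x ->
        `|ur (axis_dist x) (x 0 2)| + `|uz (axis_dist x) (x 0 2)|
          <= C0 * (ln (axis_dist x) / axis_dist x) `^ (2^-1).
Proof.
exists 1; split=> // u p ur utheta uz pr su sp axi ns decay slip _.
have zero r z : 0 < r -> 0 <= z <= 1 -> [/\ ur r z = 0, utheta r z = 0 & uz r z = 0].
  by move=> r0 z01; exact: (axisymmetric_liouville axi su sp slip ns decay r0 z01).
split; first by move=> r z r0 z01; have [] := zero r z r0 z01.
exists 2; split=> // x sx xr.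
have r0 : 0 < axis_dist x by exact: lt_le_trans xr.
have [-> _ ->] := zero _ _ r0 sx.
by rewrite normr0 addr0 mul1r powR_ge0.
Qed.
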